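(* Let $p$ be a prime and let $X$ be an indecomposable cycle set of size $p^2$. Then $X$ is isomorphic to a cycle set of one of the following forms: (1) $X = \mathbb{Z}_{p^2}$ with $x \cdot y = y + 1$. (2) $X = \mathbb{Z}_p \times \mathbb{Z}_p$ with $$(a,x) \cdot (b,y) = (b+1,\ y + \chi_0(b)S + \Phi(b-a)),$$ where $\Phi: \mathbb{Z}_p \to \mathbb{Z}_p$ is a non-constant map with $\Phi(0) = 0$, $S \in \mathbb{Z}_p$, and $\chi_0: \mathbb{Z}_p \to \mathbb{Z}_p$ is given by $\chi_0(0)=1$ and $\chi_0(x)=0$ for $x\neq 0$. The parameters $S,\Phi$ and $S',\Phi'$ define isomorphic cycle sets if and only if $S = S'$ and $\alpha \Phi = \Phi'$ for some $\alpha \in \mathbb{Z}_p^{*}$. (3) $X = \mathbb{Z}_p \times \mathbb{Z}_p$ with $$(a,x) \cdot (b,y) = (\alpha b + \alpha x,\ \alpha y + \alpha \Phi(b-a)),$$ where $\Phi: \mathbb{Z}_p \to \mathbb{Z}_p$ is a non-constant map with $\Phi(x) = \Phi(-x)$ for all $x\in\mathbb{Z}_p$, and $\alpha \in \mathbb{Z}_p^{*}$ is such that $\Phi(\alpha x) = \alpha \Phi(x)$ for all $x \in \mathbb{Z}_p$. The parameters $\alpha, \Phi$ and $\alpha', \Phi'$ define isomorphic cycle sets if and only if $\alpha = \alpha'$ and there is a $\beta \in \mathbb{Z}_p^{*}$ such that $\beta^{-1} \Phi(\beta x) = \Phi'(x)$ for all $x \in \mathbb{Z}_p$. These three cases are mutually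 exclusive.
   Context: A (non-degenerate) cycle set is a set $X$, here always finite, with a binary operation $\cdot$ such that $(x\cdot y)\cdot(x\cdot z)=(y\cdot x)\cdot(y\cdot z)$ for all $x,y,z\in X$; each map $\sigma_x: X\to X$, $\sigma_x(y)=x\cdot y$, is bijective; and the square map $x\mapsto x\cdot x$ is bijective. Homomorphisms are maps preserving the operation; isomorphisms are bijective homomorphisms. The permutation group of $X$ is $\mathcal{G}(X)=\langle \sigma_x\mid x\in X\rangle\leq \mathrm{Sym}_X$. The cycle set $X$ is indecomposable if it is not the disjoint union of two non-empty subsets each closed under $\cdot$; equivalently, $\mathcal{G}(X)$ acts transitively on $X$. $\mathbb{Z}_n$ denotes the integers modulo $n$, and $\mathbb{Z}_p^*$ the multiplicative group of the field $\mathbb{Z}_p$.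
   Formalization: In case (2) the printed criterion ''S = S' and αΦ = Φ''' is false, since (a,x) ↦ (a,αx) carries (S,Φ) to (αS,αΦ), e.g. p=3, S=1, Φ=id, α=2; the formal theorem states instead: isomorphic iff αS = S' and αΦ = Φ' for some α in Z_p^*. *)

(* Defs.v *)
From HB Require Import structures.
From mathcomp Require Import all_boot all_order all_algebra.
From mathcomp Require Import ring.

Set Implicit Arguments.
Unset Strict Implicit.
Unset Printing Implicit Defensive.

Import GRing.Theory.

Local Open Scope ring_scope.

HB.mixin Record isCycleSet X of Finite X := {
  cdot : X -> X -> X;
  cdot_cycle : forall x y z : X,
    cdot (cdot x y) (cdot x z) = cdot (cdot y x) (cdot y z);
  cdot_bij : forall x : X, bijective (cdot x);
  csquare_bij : bijective (fun x : X => cdot x x)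
}.

#[short(type="cycleSetType")]
HB.structure Definition CycleSet := {X of isCycleSet X & Finite X}.

Definition isomorphic (X Y : cycleSetType) : Prop :=
  exists f : X -> Y,
    bijective f /\ {morph f : x y / cdot x y >-> cdot x y}.

Definition cdot_closed (X : cycleSetType) (A : {set X}) : Prop :=
  {in A &, forall x y : X, cdot x y \in A}.

Definition indecomposable (X : cycleSetType) : Prop :=
  ~ exists A B : {set X},
      [/\ A != set0, B != set0, A :|: B = [set: X] & [disjoint A & B]]
      /\ cdot_closed A /\ cdot_closed B.

Definition nonconstant (A B : Type) (f : A -> B) : Prop :=
  ~ exists c : B, forall x : A, f x = c.

(* The integers mod p are 'F_p in the second and third families, so that they
   form a field for every p : nat; 'F_p is Z/pZ only when p is prime. *)

Definition chi0 (p : nat) (b : 'F_p) : 'F_p := if b == 0 then 1 else 0.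

Definition cyclic_cs (p : nat) : Type := 'Z_(p ^ 2).

Section CyclicFamily.
Variable p : nat.

HB.instance Definition _ := Finite.copy (cyclic_cs p) 'Z_(p ^ 2).

Definition cyclic_cs_op (x y : 'Z_(p ^ 2)) : 'Z_(p ^ 2) := y + 1.

Lemma cyclic_cs_cycle (x y z : cyclic_cs p) :
  cyclic_cs_op (cyclic_cs_op x y) (cyclic_cs_op x z)
  = cyclic_cs_op (cyclic_cs_op y x) (cyclic_cs_op y z).
Proof. by []. Qed.

Lemma cyclic_cs_bij (x : cyclic_cs p) :
  bijective (cyclic_cs_op x : cyclic_cs p -> cyclic_cs p).
Proof.
exists (fun y : 'Z_(p ^ 2) => y - 1) => y; rewrite /cyclic_cs_op.
  exact: addrK.
exact: subrK.
Qed.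

Lemma cyclic_cs_square :
  bijective (fun x : cyclic_cs p => cyclic_cs_op x x : cyclic_cs p).
Proof. exact: cyclic_cs_bij 0. Qed.

HB.instance Definition _ := isCycleSet.Build (cyclic_cs p)
  cyclic_cs_cycle cyclic_cs_bij cyclic_cs_square.

End CyclicFamily.

(* The conditions imposed on Phi in this family do not enter the cycle set
   axioms, hence are not arguments of the type. *)
Definition shift_cs (p : nat) (S : 'F_p) (Phi : 'F_p -> 'F_p) : Type :=
  ('F_p * 'F_p)%type.

Section ShiftFamily.
Variables (p : nat) (S : 'F_p) (Phi : 'F_p -> 'F_p).

HB.instance Definition _ := Finite.copy (shift_cs S Phi) ('F_p * 'F_p)%type.

Definition shift_cs_op (u v : 'F_p * 'F_p) : 'F_p * 'F_p :=
  let: (a, x) := u in let: (b, y) := v in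
  (b + 1, y + chi0 b * S + Phi (b - a)).

Lemma shift_cs_cycle (u v w : shift_cs S Phi) :
  shift_cs_op (shift_cs_op u v) (shift_cs_op u w)
  = shift_cs_op (shift_cs_op v u) (shift_cs_op v w).
Proof.
case: u v w => [a x] [b y] [c z] /=; congr (_, _).
have e (t : 'F_p) : c + 1 - (t + 1) = c - t by ring.
by rewrite !e; ring.
Qed.

Lemma shift_cs_bij (u : shift_cs S Phi) :
  bijective (shift_cs_op u : shift_cs S Phi -> shift_cs S Phi).
Proof.
case: u => a x.
exists (fun v : 'F_p * 'F_p =>
  (v.1 - 1, v.2 - Phi (v.1 - 1 - a) - chi0 (v.1 - 1) * S)).
  by case=> b y /=; rewrite !addrK.
by case=> b y /=; rewrite !subrK.
Qed.

Lemma shift_cs_square :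
  bijective (fun u : shift_cs S Phi => shift_cs_op u u : shift_cs S Phi).
Proof.
exists (fun v : 'F_p * 'F_p =>
  (v.1 - 1, v.2 - Phi 0 - chi0 (v.1 - 1) * S)).
  by case=> b y /=; rewrite subrr !addrK.
by case=> b y /=; rewrite subrr !subrK.
Qed.

HB.instance Definition _ := isCycleSet.Build (shift_cs S Phi)
  shift_cs_cycle shift_cs_bij shift_cs_square.

End ShiftFamily.

(* Rescaling the second coordinate multiplies S and Phi by the same unit, so S
   is determined by the isomorphism type only jointly with Phi: a criterion
   requiring S itself to be preserved while Phi is rescaled would be false. *)
Lemma shift_cs_rescale (p : nat) (S : 'F_p) (Phi : 'F_p -> 'F_p)
    (alpha : 'F_p) :
  alpha \is a GRing.unit ->
  isomorphic (shift_cs S Phi)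
    (shift_cs (alpha * S) (fun x => alpha * Phi x)).
Proof.
move=> alphaU.
exists (fun u : 'F_p * 'F_p => (u.1, alpha * u.2)); split.
  by exists (fun u : 'F_p * 'F_p => (u.1, alpha^-1 * u.2)) => -[a x] /=;
    rewrite ?mulKr ?mulVKr.
by case=> [a x] [b y]; congr (_, _) => /=; ring.
Qed.

Definition shift_admissible (p : nat) (Phi : 'F_p -> 'F_p) : Prop :=
  nonconstant Phi /\ Phi 0 = 0.

Definition even_admissible (p : nat) (alpha : 'F_p) (Phi : 'F_p -> 'F_p) :
    Prop :=
  [/\ nonconstant Phi, forall x, Phi x = Phi (- x),
      alpha \is a GRing.unit & forall x, Phi (alpha * x) = alpha * Phi x].

(* Here the cycle set axioms do need the conditions on the parameters, so the
   type carries a proof of them. *)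
Definition even_cs (p : nat) (alpha : 'F_p) (Phi : 'F_p -> 'F_p)
    (adm : even_admissible alpha Phi) : Type :=
  ('F_p * 'F_p)%type.

Section EvenFamily.
Variables (p : nat) (alpha : 'F_p) (Phi : 'F_p -> 'F_p).
Variable adm : even_admissible alpha Phi.

HB.instance Definition _ := Finite.copy (even_cs adm) ('F_p * 'F_p)%type.

Definition even_cs_op (u v : 'F_p * 'F_p) : 'F_p * 'F_p :=
  let: (a, x) := u in let: (b, y) := v in
  (alpha * b + alpha * x, alpha * y + alpha * Phi (b - a)).

Lemma even_cs_cycle (u v w : even_cs adm) :
  even_cs_op (even_cs_op u v) (even_cs_op u w)
  = even_cs_op (even_cs_op v u) (even_cs_op v w).
Proof.
have [_ PhiN _ PhiM] := adm.
case: u v w => [a x] [b y] [c z] /=; congr (_, _).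
  by rewrite -(opprB b a) -PhiN; ring.
have e (s t : 'F_p) :
  alpha * c + alpha * s - (alpha * t + alpha * s) = alpha * (c - t) by ring.
by rewrite !e !PhiM; ring.
Qed.

Lemma even_cs_bij (u : even_cs adm) :
  bijective (even_cs_op u : even_cs adm -> even_cs adm).
Proof.
have [_ _ alphaU _] := adm; case: u => a x.
pose h (v : 'F_p * 'F_p) : 'F_p * 'F_p :=
  (alpha^-1 * v.1 - x, alpha^-1 * v.2 - Phi (alpha^-1 * v.1 - x - a)).
exists h.
  by case=> b y; rewrite /h /= -!mulrDr !mulKr // !addrK.
by case=> b y; rewrite /h /= -!mulrDr !subrK !mulVKr.
Qed.

Lemma even_cs_square :
  bijective (fun u : even_cs adm => even_cs_op u u : even_cs adm).
Proof.
have [_ _ alphaU _] := adm.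
pose h (v : 'F_p * 'F_p) : 'F_p * 'F_p :=
  (alpha^-1 * v.1 - (alpha^-1 * v.2 - Phi 0), alpha^-1 * v.2 - Phi 0).
exists h.
  by case=> b y; rewrite /h /= subrr -!mulrDr !mulKr // !addrK.
by case=> b y; rewrite /h /= subrr -!mulrDr !subrK !mulVKr.
Qed.

HB.instance Definition _ := isCycleSet.Build (even_cs adm)
  even_cs_cycle even_cs_bij even_cs_square.

End EvenFamily.

Definition of_cyclic_form (p : nat) (X : cycleSetType) : Prop :=
  isomorphic X (cyclic_cs p).

Definition of_shift_form (p : nat) (X : cycleSetType) : Prop :=
  exists (S : 'F_p) (Phi : 'F_p -> 'F_p),
    shift_admissible Phi /\ isomorphic X (shift_cs S Phi).

Definition of_even_form (p : nat) (X : cycleSetType) : Prop :=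
  exists (alpha : 'F_p) (Phi : 'F_p -> 'F_p)
         (adm : even_admissible alpha Phi),
    isomorphic X (even_cs adm).

(* Main.v *)
(** Let G be the permutation group of X. Besides composition, G carries an
    abelian group law + on which it acts by automorphisms lam (a brace), with
    sigma_(g x) = lam_g sigma_x. Let tau_x and rho_x be the p-part and the
    p'-part of sigma_x for +. The tau_x generate a Sylow p-subgroup P of G, which
    is transitive on X, and they satisfy the cycle set equation again; the rho_x
    lie in a p'-subgroup Q.

    Counting fixed points of lam on P gives s <> 1 in P that is an automorphism
    of the cycle set (X, tau). Coordinates X = F_p x F_p whose second coordinate
    is translated by a central element of order p turn the cycle set equation
    into equations between functions on F_p, which a degree argument solves: the
    first coordinate moves by a constant ("shift-like") or by x ("even-like").

    To recover sigma from tau one uses that q tau_(q x) = tau_x q' with q' in Q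
    for each q in Q, and that a p'-group normalised by a group that is transitive
    on p^k points fixes every point. In the shift-like case this forces Q = 1. In
    the even-like case Q preserves the fibres of the first projection (p odd; for
    p = 2 a direct count shows rho = 1), and rho turns out to be constant: around
    a suitable origin it is multiplication by alpha. *)

Require Import Defs.
From HB Require Import structures.
From mathcomp Require Import all_boot all_order all_algebra.
From mathcomp Require Import all_fingroup all_solvable all_field ring.

Set Implicit Arguments.
Unset Strict Implicit.
Unset Printing Implicit Defensive.

Import GRing.Theory GroupScope.

Local Open Scope group_scope.

(** * The brace structure of the permutation group *)

Section PermutationBrace.

Variable X : cycleSetType.
Implicit Types (x y z u w : X) (g h : {perm X}) (l m : seq X).

Definition sigma x : {perm X} := perm (bij_inj (cdot_bij x)).

Lemma sigmaE x y : sigma x y = cdot x y.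
Proof. by rewrite permE. Qed.

Lemma sigma_cycle x y :
  sigma x * sigma (sigma x y) = sigma y * sigma (sigma y x).
Proof. by apply/permP=> z; rewrite !permM !sigmaE cdot_cycle. Qed.

Definition permgrp : {group {perm X}} := <<[set sigma x | x : X]>>%G.

Lemma mem_sigma x : sigma x \in permgrp.
Proof. by rewrite mem_gen ?imset_f. Qed.

Definition wperm_step g x := g * sigma (g x).

(* The I-structure: [wperm] sends the multiset x_1 + ... + x_n to a permutation
   so that the multiset f + h acts as f followed by (f h). *)
Definition wperm l : {perm X} := foldl wperm_step 1 l.

Lemma foldl_wperm g l : foldl wperm_step g l = g * wperm [seq g x | x <- l].
Proof.
suff E h k : foldl wperm_step (k * h) l = k * foldl wperm_step h [seq k x | x <- l].
  by rewrite /wperm -E mulg1.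
elim: l h k => //= x l IHl h k.
by rewrite /wperm_step -mulgA permM -IHl.
Qed.

Lemma wperm_cat l m : wperm (l ++ m) = wperm l * wperm [seq wperm l x | x <- m].
Proof. by rewrite /wperm foldl_cat foldl_wperm. Qed.

Lemma wperm1 x : wperm [:: x] = sigma x.
Proof. by rewrite /wperm /= /wperm_step mul1g perm1. Qed.

(** Two consecutive steps commute by the cycle set equation, so [wperm] depends only on the multiset
    of letters. The additive law inherits its commutativity from this. *)
Lemma wperm_catC l m : wperm (l ++ m) = wperm (m ++ l).
Proof.
rewrite /wperm; move: 1 => g.
have stepC k x y : wperm_step (wperm_step k x) y = wperm_step (wperm_step k y) x.
  by rewrite /wperm_step !permM -!mulgA sigma_cycle.
have swap x s k : foldl wperm_step k (x :: s) = foldl wperm_step k (s ++ [:: x]).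
  by elim: s k => //= y s IHs k; rewrite -IHs /= stepC.
elim: l m g => [|x l IHl] m g; first by rewrite cats0.
by rewrite cat_cons swap -catA IHl -catA.
Qed.

Lemma wperm_in l : wperm l \in permgrp.
Proof.
rewrite /wperm; have: 1 \in permgrp by exact: group1.
elim: l (1 : {perm X}) => //= x l IHl g Gg.
by apply: IHl; rewrite groupM ?mem_sigma.
Qed.

(** In a finite group, products of generators suffice. To append the factor [sigma x], the next
    letter is the preimage of [x] under the permutation already reached. *)
Lemma wperm_onto g : g \in permgrp -> exists l, wperm l == g.
Proof.
case/gen_prodgP=> n [c Ac ->]; elim: n c Ac => [|n IHn] c Ac.
  by exists [::]; rewrite big_ord0.
rewrite big_ord_recr /=.
have [i|l /eqP <-] := IHn (fun i => c (widen_ord (leqnSn n) i)).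
  exact: Ac.
have /imsetP[x _ ->] := Ac ord_max.
exists (l ++ [:: (wperm l)^-1 x]); rewrite wperm_cat /= permKV.
by rewrite wperm1.
Qed.

(* The permutation group again, carrying the additive law of the brace. *)
Definition addgrp : Type := subg_of permgrp.

HB.instance Definition _ := Finite.copy addgrp (subg_of permgrp).

Definition aperm_of (b : addgrp) : {perm X} := sgval (b : subg_of permgrp).

Lemma aperm_of_inj : injective aperm_of.
Proof. exact: val_inj. Qed.

Lemma aperm_of_in b : aperm_of b \in permgrp.
Proof. exact: subgP. Qed.

Lemma word_exists (b : addgrp) : exists l, wperm l == aperm_of b.
Proof. exact/wperm_onto/aperm_of_in. Qed.

Definition word (b : addgrp) : seq X := xchoose (word_exists b).

Lemma wordK b : wperm (word b) = aperm_of b.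
Proof. exact/eqP/(xchooseP (word_exists b)). Qed.

Definition ofword l : addgrp := Subg (wperm_in l).

Lemma ofwordE l : aperm_of (ofword l) = wperm l. Proof. by []. Qed.

Lemma wordofK b : ofword (word b) = b.
Proof. by apply: aperm_of_inj; rewrite ofwordE wordK. Qed.

Definition lam g (b : addgrp) : addgrp := ofword [seq g x | x <- word b].

(** With [g] written as [wperm k], commutativity turns [g] followed by the image of [l] into
    [wperm l] followed by a permutation that depends on [wperm l] and [k] alone. Hence [lam] and
    [badd] do not depend on the chosen words. *)
Lemma wperm_map_eq g l m :
  g \in permgrp -> wperm l = wperm m ->
  wperm [seq g x | x <- l] = wperm [seq g x | x <- m].
Proof.
case/wperm_onto=> k /eqP <- eq_lm; apply: (mulgI (wperm k)).
by rewrite -!wperm_cat wperm_catC wperm_cat eq_lm -wperm_cat wperm_catC.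
Qed.

Lemma lam_ofword g l :
  g \in permgrp -> lam g (ofword l) = ofword [seq g x | x <- l].
Proof.
by move=> Gg; apply: aperm_of_inj; apply: wperm_map_eq; rewrite // wordK.
Qed.

Definition badd (b c : addgrp) : addgrp := ofword (word b ++ word c).

Lemma badd_ofword l m : badd (ofword l) (ofword m) = ofword (l ++ m).
Proof.
apply: aperm_of_inj; rewrite !ofwordE !wperm_cat !wordK ofwordE; congr (_ * _).
by apply: wperm_map_eq (wperm_in l) _; rewrite wordK.
Qed.

Lemma baddE b c : aperm_of (badd b c) = aperm_of b * aperm_of (lam (aperm_of b) c).
Proof. by rewrite ofwordE wperm_cat !wordK. Qed.

Lemma badd_catC b c : badd b c = badd c b.
Proof. by apply: aperm_of_inj; rewrite ofwordE wperm_catC. Qed.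

Lemma baddA : associative badd.
Proof.
by move=> b c d; rewrite -(wordofK b) -(wordofK c) -(wordofK d) !badd_ofword catA.
Qed.

Lemma badd0 : left_id (ofword [::]) badd.
Proof. by move=> b; rewrite -(wordofK b) badd_ofword. Qed.

(** The sum of [b] and [c] is [b] followed by [lam b c]; so the opposite of [b] is the inverse
    permutation, moved by its own [lam]. *)
Definition bopp (b : addgrp) : addgrp :=
  let h := subg permgrp (aperm_of b)^-1 in lam (aperm_of h) h.

Lemma baddN : left_inverse (ofword [::]) bopp badd.
Proof.
move=> b; rewrite badd_catC; apply: aperm_of_inj; rewrite baddE /bopp.
have inG := groupVr (aperm_of_in b).
have -> : aperm_of (subg permgrp (aperm_of b)^-1) = (aperm_of b)^-1.
  exact: subgK inG.
rewrite -[subg _ _]wordofK !lam_ofword ?aperm_of_in ?groupV ?aperm_of_in //.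
rewrite -map_comp map_id_in => [|x _]; last by rewrite /= permKV.
by rewrite wordofK /aperm_of subgK ?mulgV.
Qed.

(** The additive law is written multiplicatively, so that pi-constituents and Hall subgroups make
    sense for it. *)
HB.instance Definition _ := Finite_isGroup.Build addgrp baddA badd0 baddN.

Lemma mulbE (b c : addgrp) :
  aperm_of (b * c) = aperm_of b * aperm_of (lam (aperm_of b) c).
Proof. exact: baddE. Qed.

Lemma ofword_cat l m : ofword (l ++ m) = ofword l * ofword m.
Proof. by rewrite -badd_ofword. Qed.

Lemma mulbC (b c : addgrp) : b * c = c * b.
Proof. exact: badd_catC. Qed.

Lemma aperm_of1 : aperm_of 1 = 1. Proof. by []. Qed.

Lemma lamM g : g \in permgrp -> {morph lam g : b c / b * c}.
Proof.
move=> Gg b c; rewrite -(wordofK b) -(wordofK c) -ofword_cat !lam_ofword //.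
by rewrite map_cat ofword_cat.
Qed.

Lemma lam1 b : lam 1 b = b.
Proof.
by rewrite /lam map_id_in ?wordofK // => x _; rewrite perm1.
Qed.

Lemma lam_comp g h b :
  g \in permgrp -> h \in permgrp -> lam (g * h) b = lam h (lam g b).
Proof.
move=> Gg Gh; rewrite -(wordofK b) !lam_ofword ?groupM // -map_comp.
by congr ofword; apply: eq_map => x; rewrite /= permM.
Qed.

Lemma lam_one g : g \in permgrp -> lam g 1 = 1.
Proof. by move=> Gg; rewrite -[1]/(ofword [::]) lam_ofword. Qed.

Definition vsig x : addgrp := ofword [:: x].

Lemma aperm_vsig x : aperm_of (vsig x) = sigma x.
Proof. exact: wperm1. Qed.

Lemma lam_vsig g x : g \in permgrp -> lam g (vsig x) = vsig (g x).
Proof. exact: lam_ofword. Qed.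

Lemma ofword_prod l : ofword l = \prod_(x <- l) vsig x.
Proof.
elim: l => [|x l IHl]; first by rewrite big_nil.
by rewrite big_cons -IHl -ofword_cat.
Qed.

Lemma abelian_addgrp : abelian [set: addgrp].
Proof. by apply/centsP=> b _ c _; exact: mulbC. Qed.

End PermutationBrace.

(** The points form one [G]-orbit, whose size divides the index of [P], which is prime to [p], times
    the size of a [P]-orbit. *)
Lemma sylow_transitive (T : finType) (G P : {group {perm T}}) (p k : nat) :
  prime p -> #|T| = (p ^ k)%N -> [transitive G, on [set: T] | 'P] ->
  p.-Sylow(G) P -> [transitive P, on [set: T] | 'P].
Proof.
move=> p_pr cardT trG sylP.
have cardT_gt0: (0 < #|T|)%N by rewrite cardT expn_gt0 prime_gt0.
have [x _] := card_gt0P cardT_gt0.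
have sPG := pHall_sub sylP.
have dvd: (p ^ k %| #|orbit 'P P x|)%N.
  have: (#|G : 'C_G[x | 'P]| %| #|G : P| * #|P : 'C_P[x | 'P]|)%N.
    rewrite Lagrange_index ?subsetIl // indexgS //.
    by rewrite setSI.
  rewrite -!card_orbit (atransP trG x) ?inE // cardsT cardT => dvd.
  rewrite -(Gauss_dvdr _ (_ : coprime (p ^ k) #|G : P|)) //.
  apply: coprimeXl; rewrite prime_coprime //.
  by have /and3P[_ _] := sylP; rewrite p'natE.
have orbT: orbit 'P P x = [set: T].
  apply/eqP; rewrite eqEcard subsetT cardsT cardT dvdn_leq //.
  by rewrite lt0n cards_eq0; apply/set0Pn; exists x; apply: orbit_refl.
by apply/imsetP; exists x; rewrite ?inE ?orbT.
Qed.

(** * Splitting the brace into its pi-parts *)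

Section BraceSplit.

Variable X : cycleSetType.
Implicit Types (x y z u w : X) (g h q : {perm X}) (l m : seq X).
Implicit Types (b c : addgrp X) (pi : nat_pred).

Local Notation G := (permgrp X).

Lemma lam_in_morph g : g \in G ->
    {in [set: addgrp X] &, {morph lam g : b c / b * c}}.
Proof. by move=> Gg b c _ _; apply: lamM. Qed.

Lemma lam_constt pi g b : g \in G -> lam g b.`_pi = (lam g b).`_pi.
Proof.
move=> Gg; exact: (morph_constt (Morphism (lam_in_morph Gg)) pi (in_setT b)).
Qed.

Lemma lam_p_elt pi g b : g \in G -> pi.-elt b -> pi.-elt (lam g b).
Proof. by move=> Gg /constt_p_elt <-; rewrite lam_constt // p_elt_constt. Qed.

Lemma p_eltM pi b c : pi.-elt b -> pi.-elt c -> pi.-elt (b * c).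
Proof.
move=> /constt_p_elt <- /constt_p_elt <-.
by rewrite -consttM ?p_elt_constt //; exact: mulbC.
Qed.

Definition bset pi : {set {perm X}} :=
  [set aperm_of b | b : addgrp X & pi.-elt b].

Lemma mem_bset pi b : pi.-elt b -> aperm_of b \in bset pi.
Proof. by move=> pib; apply: imset_f; rewrite inE. Qed.

(** The composite of [b] and [c] is the sum of [b] and the image of [c] under [lam b^-1], and [lam]
    preserves additive pi-elements. *)
Lemma bset_group_set pi : group_set (bset pi).
Proof.
apply/group_setP; split.
  by rewrite -(aperm_of1 X) mem_bset //= /p_elt order1.
move=> g h /imsetP[b]; rewrite inE => pib -> /imsetP[c]; rewrite inE => pic ->.
have Gb := aperm_of_in b; have GVb := groupVr Gb.
have -> : c = lam (aperm_of b) (lam (aperm_of b)^-1 c).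
  by rewrite -lam_comp // mulVg lam1.
by rewrite -mulbE mem_bset // p_eltM ?lam_p_elt.
Qed.

Canonical bset_group pi := Group (bset_group_set pi).

Lemma bset_sub pi : bset pi \subset G.
Proof. by apply/subsetP=> _ /imsetP[b _ ->]; apply: aperm_of_in. Qed.

(** A count: [aperm_of] matches [G] with the additive group, and [bset pi] with the Hall pi-subgroup
    of that abelian group. *)
Lemma bset_Hall pi : pi.-Hall(G) (bset pi).
Proof.
have cardG : #|[set: addgrp X]| = #|G|.
  rewrite -(card_imset _ (@aperm_of_inj X)); congr #|pred_of_set _|.
  apply/setP=> g; apply/imsetP/idP=> [[b _ ->]|Gg]; first exact: aperm_of_in.
  exists (subg G g : addgrp X); first by rewrite inE.
  by rewrite /aperm_of subgK.
rewrite pHallE bset_sub /= -cardG card_imset; last exact: aperm_of_inj.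
have nilB : nilpotent [set: addgrp X] := abelian_nil (abelian_addgrp X).
rewrite -(card_Hall (nilpotent_pcore_Hall pi nilB)); apply/eqP.
apply: eq_card => b; rewrite inE; symmetry; apply: mem_normal_Hall.
- exact: nilpotent_pcore_Hall.
- exact: pcore_normal.
- by rewrite inE.
Qed.

Definition part pi x : {perm X} := aperm_of (vsig x).`_pi.

Lemma part_in pi x : part pi x \in bset pi.
Proof. by rewrite mem_bset ?p_elt_constt. Qed.

Lemma lam_part pi g x : g \in G -> lam g (vsig x).`_pi = (vsig (g x)).`_pi.
Proof. by move=> Gg; rewrite lam_constt // lam_vsig. Qed.

Lemma bset_gen pi : bset pi = <<[set part pi x | x : X]>>.
Proof.
apply/eqP; rewrite eqEsubset gen_subG andbC; apply/andP; split.
  by apply/subsetP=> _ /imsetP[x _ ->]; apply: part_in.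
apply/subsetP=> g0 /imsetP[b]; rewrite inE => /constt_p_elt <- ->.
rewrite -(wordofK b) ofword_prod.
have prodE (l : seq X) :
    (\prod_(x <- l) vsig x).`_pi = \prod_(x <- l) (vsig x).`_pi.
  elim: l => [|x l IHl]; first by rewrite !big_nil constt1.
  by rewrite !big_cons consttM ?IHl //; apply: mulbC.
rewrite {}prodE.
(* Peeling off the letter [x] moves the remaining letters by [part pi x], so the induction is on the
   length rather than on the list. *)
have [n] := ubnP (size (word b)); elim: n (word b) => // n IHn [|x l] /= le_l.
  by rewrite big_nil group1.
have gen_x : part pi x \in <<[set part pi y | y : X]>> by rewrite mem_gen ?imset_f.
rewrite big_cons mulbE -[aperm_of (vsig x).`_pi]/(part pi x) (groupM gen_x) //.
set g := part pi x; have Gg : g \in G := aperm_of_in _.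
rewrite (big_morph (lam g) (lamM Gg) (lam_one Gg)).
under eq_bigr => y _ do rewrite lam_part //.
by rewrite -(big_map g xpredT (fun y => (vsig y).`_pi)) IHn // size_map.
Qed.

(** Both sides are the permutation attached to the sum of the pi-parts of [x] and [y] in the
    additive group. *)
Lemma part_cycle pi x y :
  part pi x * part pi (part pi x y) = part pi y * part pi (part pi y x).
Proof.
have E u w : part pi u * part pi (part pi u w)
           = aperm_of ((vsig u).`_pi * (vsig w).`_pi).
  by rewrite mulbE lam_part // aperm_of_in.
by rewrite !E mulbC.
Qed.

(** The hypothesis says that two sums of pi-parts agree in the additive group; [lam g] is additive
    and moves the points by [g]. *)
Lemma part_par pi g u w u' w' : g \in G ->
  part pi u * part pi (part pi u w) = part pi u' * part pi (part pi u' w') ->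
  part pi (g u) * part pi (part pi (g u) (g w))
  = part pi (g u') * part pi (part pi (g u') (g w')).
Proof.
move=> Gg.
have E x y : part pi x * part pi (part pi x y)
           = aperm_of ((vsig x).`_pi * (vsig y).`_pi).
  by rewrite mulbE lam_part // aperm_of_in.
rewrite !E => /(@aperm_of_inj X) /(congr1 (lam g)).
by rewrite !(lamM Gg) !(lam_part _ _ Gg) => ->.
Qed.

Lemma part_congr pi g u w :
  g \in G -> part pi u = part pi w -> part pi (g u) = part pi (g w).
Proof.
move=> Gg /(@aperm_of_inj X) /(congr1 (lam g)).
by rewrite !(lam_part _ _ Gg) /part => ->.
Qed.

(** [vsig x] is the sum of its two constituents, and [lam] of the first moves the base point of the
    second. *)
Lemma sigma_split pi x : sigma x = part pi x * part pi^' (part pi x x).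
Proof.
rewrite -aperm_vsig -{1}(consttC pi (vsig x)) mulbE.
by rewrite lam_part ?aperm_of_in.
Qed.

Definition matched g q : {perm X} := aperm_of (lam g (subg G q : addgrp X)).

Lemma aperm_subg q : q \in G -> aperm_of (subg G q : addgrp X) = q.
Proof. exact: subgK. Qed.

Lemma subg_aperm b : (subg G (aperm_of b) : addgrp X) = b.
Proof. exact: (@sgvalK _ G b). Qed.

Lemma matched_in pi g q : g \in G -> q \in bset pi -> matched g q \in bset pi.
Proof.
move=> Gg /imsetP[b]; rewrite inE => pib ->.
by rewrite /matched subg_aperm mem_bset ?lam_p_elt.
Qed.

(** The sum of [q] and the pi-part of [x] in the additive group is read in its two orders. *)
Lemma matchedP pi q x : q \in G ->
  q * part pi (q x) = part pi x * matched (part pi x) q.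
Proof.
move=> Gq; rewrite /matched /part -(lam_part _ _ Gq).
by rewrite -{1 2}(aperm_subg Gq) -!mulbE mulbC.
Qed.

Lemma part_matched pi g x : g \in G -> part pi (g x) = matched g (part pi x).
Proof. by move=> Gg; rewrite /matched subg_aperm (lam_part _ _ Gg). Qed.

Lemma lamactP : is_action G (fun b g => if g \in G then lam g b else b).
Proof.
split=> [g b c | b g h Gg Gh] /=; last by rewrite groupM // Gg Gh lam_comp.
case: ifP => // Gg eqbc.
by rewrite -[b](lam1) -[c](lam1) -(mulgV g) !lam_comp ?groupV ?eqbc.
Qed.

Definition lamact := Action lamactP.

(* A non-trivial P-fixed point of the p-part of the brace exists by counting. *)
Lemma part_automorphism (p : nat) : prime p -> bset p :!=: 1 ->
  exists s, [/\ s \in bset p, s != 1 & forall x, part p (s x) = part p x ^ s].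
Proof.
move=> p_pr ntP.
have pP : p.-group (bset p) := pHall_pgroup (bset_Hall p).
pose S : {set addgrp X} := [set b | p.-elt b].
have actsP : [acts bset p, on S | lamact].
  apply/subsetP=> g Pg; have Gg := subsetP (bset_sub p) g Pg.
  rewrite inE Gg inE; apply/subsetP=> b; rewrite !inE /= Gg.
  exact: lam_p_elt.
have cardS : #|S| = #|bset p| by rewrite card_imset //; apply: aperm_of_inj.
have := pgroup_fix_mod pP actsP; rewrite cardS.
have [_ p_dv _] := pgroup_pdiv pP ntP.
rewrite (eqP p_dv) => fix0.
have F1 : 1 \in 'Fix_(S | lamact)(bset p).
  rewrite !inE /p_elt order1 /=; apply/subsetP=> g Pg.
  have Gg := subsetP (bset_sub p) g Pg.
  by rewrite inE /= Gg lam_one.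
have : (1 < #|'Fix_(S | lamact)(bset p)|)%N.
  have : p %| #|'Fix_(S | lamact)(bset p)| by rewrite /dvdn -fix0.
  move/dvdn_leq/(leq_trans (prime_gt1 p_pr)); apply.
  by apply/card_gt0P; exists 1.
rewrite (cardsD1 1) F1 ltnS => /card_gt0P[b]; rewrite !inE => /and3P[b1 pb fixb].
exists (aperm_of b); split=> [||x]; first exact: mem_bset.
  by apply: contraNneq b1; rewrite -(aperm_of1 X) => /aperm_of_inj ->.
have Px := part_in p x; have Gx := subsetP (bset_sub p) _ Px.
have := subsetP fixb _ Px; rewrite inE /= Gx => /eqP lamb.
(* Since [lam] of [part p x] fixes [b], the two orders of adding [b] and the p-part of [x] give
   [s * part p (s x) = part p x * s]. *)
apply: (mulgI (aperm_of b)); rewrite -conjgC /part.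
rewrite -lam_part ?aperm_of_in // -mulbE mulbC mulbE.
by rewrite -[aperm_of _.`_p]/(part p x) lamb.
Qed.

End BraceSplit.

Local Open Scope ring_scope.

(** * Functions on a prime field *)

Section DifferenceCalculus.

Variables (p : nat) (F : finFieldType).
Hypotheses (charF : p \in [pchar F]) (cardF : #|F| = p).
Implicit Types (f g h : F -> F).

Let p_pr : prime p := pcharf_prime charF.

Lemma natr_modp (m n : nat) : m = n %[mod p] <-> m%:R = n%:R :> F.
Proof.
split=> [e|e].
  by rewrite (divn_eq m p) (divn_eq n p) e !natrD !natrM (pcharf0 charF) !mulr0.
apply/eqP; wlog le_mn : m n e / (m <= n)%N.
  move=> IH; case: (leqP m n) => [|/ltnW] le; first exact: IH.
  by rewrite eq_sym IH.
by rewrite eq_sym eqn_mod_dvd // (dvdn_pcharf charF) natrB // e subrr.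
Qed.

Lemma prime_field_natr (x : F) : exists i : 'I_p, x == (i : nat)%:R.
Proof.
have f_inj : injective (fun i : 'I_p => (i : nat)%:R : F).
  move=> i j /natr_modp; rewrite !modn_small // => ij; exact: val_inj.
have /codomP[i ->] := inj_card_onto f_inj (eq_leq (etrans cardF (esym (card_ord
    p)))) x.
by exists i.
Qed.

Lemma shift_iter (T : Type) (h : F -> T) (m : F) (op : T -> T) :
  (forall y, h (y + m) = op (h y)) ->
  forall n y, h (y + n%:R * m) = iter n op (h y).
Proof.
move=> hm; elim=> [|n IHn] y; first by rewrite mul0r addr0.
by rewrite iterS -IHn -hm; congr h; rewrite mulrSr; ring.
Qed.

(** The field has [p] elements, so every [y] is a multiple of the nonzero [m]. *)
Lemma shift_const (T : Type) (h : F -> T) (m : F) :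
  m != 0 -> (forall y, h (y + m) = h y) -> forall y, h y = h 0.
Proof.
move=> m0 hm y; have [n /eqP e] := prime_field_natr (y / m).
have := shift_iter (op := id) hm n 0.
by rewrite -e divfK // add0r => ->; elim: (nat_of_ord n).
Qed.

Lemma shift_linear h (m d : F) :
  m != 0 -> (forall y, h (y + m) = h y + d) -> forall y, h y = h 0 + y * (d / m).
Proof.
move=> m0 hm y; pose k y := h y - y * (d / m).
have /(_ y) : forall y, k y = k 0.
  apply: (shift_const m0) => z; by rewrite /k hm; field; exact: m0.
by rewrite /k mul0r subr0 => <-; ring.
Qed.

Definition delta h : F -> F := fun x => h (x + 1) - h x.

Local Notation D n h := (iter n delta h).

Lemma delta_ext n f g : f =1 g -> D n f =1 D n g.
Proof. by move=> fg; elim: n => //= n IHn x; rewrite /delta !IHn. Qed.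

Lemma delta_sub n f g x : D n (fun x => f x - g x) x = D n f x - D n g x.
Proof.
by elim: n x => //= n IHn x; rewrite /delta !IHn; ring.
Qed.

Lemma delta_scale n (a : F) f x : D n (fun x => a * f x) x = a * D n f x.
Proof.
by elim: n x => //= n IHn x; rewrite /delta !IHn; ring.
Qed.

Lemma delta_shift n (c : F) f x : D n (fun x => f (x + c)) x = D n f (x + c).
Proof.
by elim: n x => //= n IHn x; rewrite /delta !IHn; congr (D n f _ - _); ring.
Qed.

Lemma delta_binomial n h x :
  D n h x = \sum_(i < n.+1) (-1) ^+ (n + i) * 'C(n, i)%:R * h (x + i%:R).
Proof.
elim: n x => [|n IHn] x.
  by rewrite big_ord_recl big_ord0 /= bin0 expr0 !mul1r !addr0.
rewrite iterS {1}/delta !IHn [RHS]big_ord_recl big_ord_recr /=.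
rewrite [in RHS]big_ord_recr /= !bin0 !binn.
rewrite [X in _ - X]big_ord_recl /= bin0.
have -> : \sum_(i < n) (-1) ^+ (n.+1 + bump 0 i) * 'C(n.+1, bump 0 i)%:R
            * h (x + (bump 0 i)%:R)
  = \sum_(i < n) (-1) ^+ (n + i) * 'C(n, i)%:R * h (x + 1 + i%:R)
    - \sum_(i < n) (-1) ^+ (n + bump 0 i) * 'C(n, bump 0 i)%:R
        * h (x + (bump 0 i)%:R).
  rewrite -sumrB; apply: eq_bigr => i _.
  rewrite /bump /= add1n binS natrD !addSn !addnS !exprS mulrSr.
  have -> : x + 1 + i%:R = x + (i%:R + 1) by ring.
  by ring.
rewrite /bump /= !add1n !addn0 !addnS !addSn !exprS.
have -> : x + 1 + n%:R = x + (n%:R + 1) by ring.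
by rewrite [n.+1%:R]mulrSr; ring.
Qed.

(** In characteristic [p] only the two end terms of the binomial expansion survive, and they cancel
    because [x + p%:R = x]. *)
Lemma delta_nilpotent h x : D p h x = 0.
Proof.
have m1p : (-1) ^+ p = -1 :> F.
  by rewrite -[LHS](pFrobenius_autE charF) pFrobenius_autN pFrobenius_aut1.
have [q def_p] : exists q, p = q.+1 by exists p.-1; rewrite prednK ?prime_gt0.
rewrite {1}def_p delta_binomial big_ord_recl big_ord_recr big1 => [|i _];
    last first.
  suff -> : ('C(q.+1, bump 0 i)%:R = 0 :> F) by rewrite mulr0 mul0r.
  apply/eqP; rewrite -def_p -(dvdn_pcharf charF) prime_dvd_bin //.
  by rewrite /bump /= add1n def_p ltnS.
rewrite /= add0r /bump /= add1n -!def_p bin0 binn addn0 (pcharf0 charF) !addr0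
    mulr1.
by rewrite mulr1 exprD !m1p; ring.
Qed.

Lemma delta0_const h : (forall x, delta h x = 0) -> forall x, h x = h 0.
Proof.
move=> dh; apply: (shift_const (m := 1)) => [|y]; first exact: oner_neq0.
by apply/eqP; rewrite -subr_eq0; apply/eqP/dh.
Qed.

(* If f has degree e + 1, then the difference of order e in y of
   f (y + g x) - f y is (D^(e+1) f) * g x, so the hypothesis bounds the degree
   of g. *)
Lemma degree_drop e f g :
  (forall x, D e.+2 f x = 0) ->
  (forall y x, D e.+1 (fun x => f (y + g x) - f y) x = 0) ->
  forall x, D e.+1 f 0 * D e.+1 g x = 0.
Proof.
move=> Df Dfg x.
have Dj j y z : D e.+1 (fun x => D j f (y + g x) - D j f y) z = 0.
  elim: j y z => [|j IHj] y z; first exact: Dfg.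
  rewrite -[RHS](subrr 0) -{1}(IHj (y + 1) z) -(IHj y z) -delta_sub.
  apply: delta_ext => t; rewrite /= /delta.
  have -> : y + g t + 1 = y + 1 + g t by ring.
  by ring.
have Def y : D e.+1 f y = D e.+1 f 0 := delta0_const Df y.
have lin y : D e f y = D e f 0 + y * (D e.+1 f 0 / 1).
  apply: shift_linear => [|z]; first exact: oner_neq0.
  by rewrite -(Def z) iterS [delta _ z]/delta; ring.
rewrite -delta_scale -[RHS](Dj e 0 x); apply: delta_ext => t.
by rewrite (lin (0 + g t)) divr1; ring.
Qed.

(** Descending induction on the degree in the first variable. At [k = w] the right-hand side is a
    difference of translates in [x], which loses one degree; [degree_drop], applied to [f^~ w] on
    both sides, then makes the square of the leading difference vanish. *)
Lemma exchange_constant (f : F -> F -> F) :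
  (forall x y k w, f (y + f x k) w - f y w
                   = f (x + f y (- k)) (w + k) - f x (w + k)) ->
  forall x w, f x w = f 0 w.
Proof.
move=> ef x w.
suff D1 n w' z : D n.+1 (f^~ w') z = 0.
  exact: (delta0_const (D1 0 w)).
have [m] := ubnP (p - n); elim: m n w' z => // m IHm n w' z.
case: (leqP p n.+1) => [le_pn _|lt_np le_m].
  rewrite -(subnK le_pn) iterD.
  have E : D p (f^~ w') =1 (fun=> 0) := delta_nilpotent (f^~ w').
  rewrite (delta_ext _ E); elim: (_ - p)%N z => //= k IHk z.
  by rewrite /delta !IHk subrr.
have {}IHm w2 y : D n.+2 (f^~ w2) y = 0.
  by apply: IHm; rewrite subnS prednK ?subn_gt0 // ltnW.
have cst w2 y : D n.+1 (f^~ w2) y = D n.+1 (f^~ w2) 0 := delta0_const (IHm w2) y.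
rewrite cst; apply/eqP; rewrite -[_ == 0]orbb -mulf_eq0; apply/eqP.
apply: degree_drop => [y|y t]; first exact: IHm.
rewrite (delta_ext _ (fun t => ef t y w' w')) delta_sub.
by rewrite (delta_shift n.+1 (f y (- w')) (f^~ (w' + w'))) !(cst (w' + w')) subrr.
Qed.

Corollary translation_cycle_constant f :
  (forall a b, f (b + f a) + f a = f (a + f b) + f b) -> forall a, f a = f 0.
Proof.
move=> ef a; apply: (exchange_constant (f := fun x _ => f x)) 0 => x y _ _.
by apply/eqP; rewrite subr_eq addrAC eq_sym subr_eq eq_sym ef.
Qed.

End DifferenceCalculus.

(** * The cycle set equation in coordinates *)

Section CocycleEquations.

Variables (p : nat) (F : finFieldType).
Hypotheses (charF : p \in [pchar F]) (cardF : #|F| = p).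
Variables (c : F -> F -> F) (f : F -> F -> F -> F).

(** These are the two coordinates of the cycle set equation when (a, x) sends (b, y) to (b + c a x,
    y + f a x b). In [eqf], [w] is the first coordinate of the point at which both sides are
    evaluated. *)
Hypothesis eqc : forall a x b y,
  c (b + c a x) (y + f a x b) + c a x = c (a + c b y) (x + f b y a) + c b y.
Hypothesis eqf : forall a x b y w,
  f (b + c a x) (y + f a x b) (w + c a x) + f a x w
  = f (a + c b y) (x + f b y a) (w + c b y) + f b y w.

(** The automorphism is (a, x) -> (a, x + s a). It makes [c] independent of [x], which reduces [eqc]
    to [translation_cycle_constant], and makes [f] affine in [x]; [eqf] then kills the slope. *)
Lemma vertical_automorphism (s : F -> F) a0 a1 x1 :
  s a0 != 0 -> c a1 x1 != 0 ->
  (forall a x, c a (x + s a) = c a x) ->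
  (forall a x b, f a (x + s a) b + s b = s (b + c a x) + f a x b) ->
  exists c0 f0, [/\ c0 != 0, forall a x, c a x = c0 &
                    forall a x b, f a x b = f0 a b].
Proof.
move=> sa0 ca1 cs fs.
have c_block a x : c a x = c a 0.
  (* If [s a] is zero but [c a y] is not, then [fs] makes [s] invariant under translation by
     [c a y], hence zero, against [s a0 != 0]. *)
  have [sa|sa] := eqVneq (s a) 0; last first.
    exact: (shift_const charF cardF (h := c a) sa (cs a)).
  suff c0 y : c a y = 0 by rewrite !c0.
  apply/eqP/negPn/negP=> cay.
  have s_const : forall b, s b = s 0.
    apply: (shift_const charF cardF) cay _ => b; have := fs a y b;
        rewrite sa addr0 addrC.
    by move/addIr.
  by move: sa0; rewrite s_const -(s_const a) sa eqxx.
have c_cycle a b : c (b + c a 0) 0 + c a 0 = c (a + c b 0) 0 + c b 0.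
  have := eqc a 0 b 0.
  by rewrite (c_block (b + _)) (c_block (a + _)).
have c_const a x : c a x = c 0 0.
  by rewrite c_block (translation_cycle_constant charF cardF c_cycle).
have s_neq0 a : s a != 0.
  apply/eqP=> sa; have s_const : forall b, s b = s 0.
    apply: (shift_const charF cardF) ca1 _ => b.
    by have := fs a 0 b; rewrite sa addr0 addrC c_const -(c_const a1 x1) => /addIr.
  by move: sa0; rewrite s_const -(s_const a) sa eqxx.
have [k ck] : exists k, forall a x, c a x = k by exists (c 0 0).
have k0 : k != 0 by rewrite -(ck a1 x1).
have fE a x b : f a x b = f a 0 b + x * ((s (b + k) - s b) / s a).
  apply: (shift_linear charF cardF (h := fun x => f a x b) (s_neq0 a)) => y.
  by have := fs a y b; rewrite ck => e; apply: (addIr (s b)); rewrite e; ring.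
(* The instances of [eqf] at second coordinates [s b'] and 0 are subtracted; only the slopes found
   in [fE] remain. *)
have key b a b' : (s (b + k + k) - s (b + k)) * (s b' / s (b' + k) + s a / s (a
    + k) - 1)
                  = s (b + k) - s b.
  have e1 := eqf a 0 b' (s b') b; have e0 := eqf a 0 b' 0 b.
  rewrite !ck (fE (b' + k) (s b' + _)) (fE (a + k) (0 + _)) !(fE b' (s b')) in e1.
  rewrite !ck (fE (b' + k) (0 + _)) (fE (a + k) (0 + _)) in e0.
  apply/eqP; rewrite -subr_eq0; apply/eqP.
  move: (s_neq0 b') (s_neq0 (b' + k)) (s_neq0 (a + k)) => n1 n2 n3.
  have comb (L1 R1 L0 R0 K : F) : L1 = R1 -> L0 = R0 ->
      K = L1 - R1 - (L0 - R0) -> K = 0.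
    by move=> -> -> ->; ring.
  by apply: (comb _ _ _ _ _ e1 e0); field; rewrite n1 n2 n3.
(* Otherwise [key] makes the ratio of [s a] to [s (a + k)] independent of [a], so [s] is geometric
   along [k]; returning after [p] steps, Fermat forces the ratio 1. *)
have s_shift b : s (b + k) - s b = 0.
  apply/eqP/negPn/negP=> kb.
  have kb' : s (b + k + k) - s (b + k) != 0.
    by apply: contraNneq kb => e; rewrite -(key b 0 0) e mul0r.
  have r_const a : s a / s (a + k) = s 0 / s (0 + k).
    have := etrans (key b a 0) (esym (key b 0 0)).
    by move/(mulfI kb')/(addIr (- 1))/addrI.
  set r := s 0 / s (0 + k) in r_const.
  have s_geom a : s (a + k) = r^-1 * s a.
    by rewrite -(r_const a) invfM invrK mulrAC mulVf ?mul1r.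
  have := shift_iter s_geom p b; rewrite (pcharf0 charF) mul0r addr0 iter_mulr.
  rewrite -[in _ ^+ _]cardF expf_card => e.
  by move: kb; rewrite s_geom -e subrr eqxx.
exists k, (fun a b => f a 0 b); split=> // a x b; rewrite fE.
by rewrite s_shift mul0r mulr0 addr0.
Qed.

(** The automorphism is (a, x) -> (a + 1, x). As a function of [x] and [b - a], [f] satisfies
    [exchange_constant], hence depends on [b - a] alone. By [eqc] the increments of [c] over values
    of [Phi] do not depend on the base point, so [c] is affine as soon as [Phi] is nonzero
    somewhere. *)
Lemma horizontal_automorphism :
  (forall a x, c (a + 1) x = c a x) ->
  (forall a x b, f (a + 1) x (b + 1) = f a x b) ->
  exists Phi : F -> F,
    (forall a x b, f a x b = Phi (b - a)) /\
    ((exists k, Phi k != 0) ->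
     exists g d, (forall a x, c a x = g * x + d) /\
                 forall k, g * Phi k = g * Phi (- k)).
Proof.
move=> c1 f1.
have cE a x : c a x = c 0 x.
  exact: (shift_const charF cardF (h := c^~ x) (oner_neq0 F) (fun b => c1 b x) a).
have fE a x b : f a x b = f 0 x (b - a).
  have n1 : 1 != 0 :> F := oner_neq0 F.
  have inv t : f (a + (t + 1)) x (b + (t + 1)) = f (a + t) x (b + t).
    by rewrite !addrA f1.
  have := shift_const charF cardF (h := fun t => f (a + t) x (b + t)) n1 inv (- a).
  by rewrite subrr !addr0.
pose h x k := f 0 x k.
have h_const x k : h x k = h 0 k.
  apply: (exchange_constant charF cardF) => {k}x y k w.
  have e := eqf 0 x k y (w + k).
  rewrite (cE k y) (fE (k + _)) add0r (fE (c 0 y)) (fE k y 0) (fE k y) sub0r in e.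
  have r1 : w + k + c 0 x - (k + c 0 x) = w by ring.
  rewrite r1 !addrK in e.
  by apply/eqP; rewrite subr_eq addrAC eq_sym subr_eq -e.
exists (h 0); split=> [a x b|[k hk]]; first by rewrite fE -(h_const x).
have cc x y j : c 0 (y + h 0 j) - c 0 y = c 0 (x + h 0 (- j)) - c 0 x.
  have e := eqc 0 x j y.
  rewrite (cE (j + _)) (cE j y) (cE (0 + _)) (fE j y 0) sub0r in e.
  rewrite -[f 0 x j]/(h x j) -[f 0 y (- j)]/(h y (- j)) h_const (h_const y) in e.
  by apply/eqP; rewrite subr_eq addrAC eq_sym subr_eq -e.
have lin := shift_linear charF cardF (h := c 0) (d := c 0 (h 0 k) - c 0 0) hk.
have {}lin x : c 0 x = c 0 0 + x * ((c 0 (h 0 k) - c 0 0) / h 0 k).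
  apply: lin => y; have := cc 0 y k; have := cc 0 0 k; rewrite !add0r => <- e.
  by rewrite -e; ring.
set g := _ / _ in lin; exists g, (c 0 0); split=> [a x|j].
  by rewrite cE lin; ring.
have := cc 0 0 j; rewrite !add0r (lin (h 0 j)) (lin (h 0 (- j))) => e.
by rewrite !(mulrC g); apply: (addrI (c 0 0)); apply: (addIr (- c 0 0)).
Qed.


End CocycleEquations.

(** * Cycle sets whose permutation group is a p-group *)

Section Coordinates.

Variables (p : nat) (F : finFieldType).
Hypotheses (charF : p \in [pchar F]) (cardF : #|F| = p).
Variables (X : finType) (P : {group {perm X}}).
Hypotheses (cardX : #|X| = (p ^ 2)%N) (pP : p.-group P)
  (trP : [transitive P, on [set: X] | 'P]).

Let p_pr : prime p := pcharf_prime charF.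

Lemma expg_field (gT : finGroupType) (g : gT) (m n : nat) :
  #[g]%g = p -> m%:R = n%:R :> F -> (g ^+ m = g ^+ n)%g.
Proof.
by move=> og /(natr_modp charF) e; apply/eqP; rewrite eq_expg_mod_order og e.
Qed.

(** A central [z] of order [p] acts semiregularly, by transitivity. Its orbits are the fibres,
    permuted through [P / D], and the point with coordinates (b, y) is the image of [x0] under
    [t^b z^y]. Since [P] commutes with [z], it translates fibres. The condition on [t ^+ p] lets [t]
    pass from the last fibre to the first without a shift. *)
Lemma coordinates : exists D : {group {perm X}},
  [/\ D <| P, #|P : D|%g = p &
   forall t, t \in P -> t \notin D ->
   exists (e : F * F -> X) (phi : {perm X} -> F),
   [/\ bijective e,
       forall g, g \in P -> exists w, forall b y,
         g (e (b, y)) = e (b + phi g, y + w b),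
       forall g, g \in D -> phi g = 0 &
       (t ^+ p = 1)%g -> forall b y, t (e (b, y)) = e (b + 1, y)]].
Proof.
have cardX_gt0 : (0 < #|X|)%N by rewrite cardX expn_gt0 prime_gt0.
have [x0 _] := card_gt0P cardX_gt0.
have orbP : orbit 'P P x0 = [set: X] by rewrite (atransP trP) ?inE.
have toX x : exists2 g, g \in P & g x0 = x.
  by have : x \in orbit 'P P x0; [rewrite orbP inE | case/orbitP=> g Pg <-;
      exists g].
pose S := 'C_P[x0 | 'P]%G.
have memS g : g \in P -> (g \in S) = (g x0 == x0).
  by move=> Pg; rewrite !inE Pg /= sub1set inE.
have cardP : #|P| = (p ^ 2 * #|S|)%N.
  by rewrite -(card_orbit_stab 'P P x0) orbP cardsT cardX.
have ntZ : 'Z(P) != 1%g.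
  apply: contraTneq isT => /(trivg_center_pgroup pP) P1.
  have : #|P| = 1%N by rewrite P1 cards1.
  move/eqP; rewrite cardP muln_eq1 -(exp1n 2) eqn_exp2r // => /andP[/eqP p1 _].
  by move: p_pr; rewrite p1.
have [_ pZ _] := pgroup_pdiv (pgroupS (center_sub P) pP) ntZ.
have [z Zz oz] := Cauchy p_pr pZ.
have Pz : z \in P := subsetP (center_sub P) z Zz.
have cPz g : g \in P -> commute g z.
  by move=> Pg; apply/commute_sym/(centP (subsetP (subsetIr P _) z Zz)).
have cPzX n g x : g \in P -> g ((z ^+ n)%g x) = (z ^+ n)%g (g x).
  by move=> Pg; rewrite -!permM (commuteX n (cPz g Pg)).
have z_semireg h : h \in <[z]>%g -> h x0 = x0 -> h = 1%g.
  case/cycleP=> n -> fix0; apply/permP=> x; have [g Pg <-] := toX x.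
  by rewrite perm1 -cPzX // fix0.
have cSZ : (<[z]> \subset 'C(S))%g.
  rewrite cycle_subG; apply/centP=> g Sg; apply/commute_sym/cPz.
  by case/setIP: Sg.
(* [D] is the setwise stabiliser of the [<[z]>]-orbit of [x0]; it has index [p], hence is normal in
   the p-group [P]. *)
pose D := (S <*> <[z]>)%G.
have defD : D :=: (S * <[z]>)%g by rewrite /= cent_joinEr.
have sDP : D \subset P by rewrite join_subG subsetIl cycle_subG.
have cardD : #|D| = (#|S| * p)%N.
  rewrite defD TI_cardMg -?oz //; apply/trivgP/subsetP=> g /setIP[Sg /cycleP[n dg]].
  rewrite inE; apply/eqP; apply: z_semireg; rewrite dg ?mem_cycle // -dg.
  by apply/eqP; rewrite -memS //; case/setIP: Sg.
have iD : #|P : D|%g = p.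
  rewrite -divgS // cardP cardD expnS expn1 -mulnA [(p * #|S|)%N]mulnC.
  by rewrite mulnK // muln_gt0 cardG_gt0 prime_gt0.
have nsDP : D <| P.
  by apply: (p_maximal_normal pP); apply: p_index_maximal; rewrite // iD.
exists D; split=> // t Pt nDt.
have nDP := normal_norm nsDP.
have cardQ : #|P / D|%g = p by rewrite card_quotient.
have ot : #[coset D t]%g = p.
  apply/prime_nt_dvdP => //; last by rewrite -cardQ order_dvdG ?mem_quotient.
  by apply: contraNneq nDt => /eqP; rewrite order_eq1 => /eqP/coset_idr; apply;
      apply: (subsetP nDP).
have genQ g : g \in P -> exists k : 'I_p, coset D g == (coset D t ^+ k)%g.
  move=> Pg; have /cycleP[k ->] : coset D g \in <[coset D t]>%g.
    have -> : <[coset D t]>%g = (P / D)%g.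
      by apply/eqP; rewrite eqEcard cycle_subG mem_quotient //= cardQ -ot.
    exact: mem_quotient.
  have lt_k : (k %% p < p)%N by rewrite ltn_mod prime_gt0.
  by exists (Ordinal lt_k); rewrite /= -ot expg_mod_order.
(* The exponent of [t] that gives [g] modulo [D]; by [genQ] the default 0 is never reached for [g]
   in [P]. *)
pose phi g : F := if [pick k : 'I_p | coset D g == (coset D t ^+ k)%g] is Some k
                  then (k : nat)%:R else 0.
have phiE g (k : nat) : g \in P -> coset D g = (coset D t ^+ k)%g -> phi g = k%:R.
  move=> Pg dg; rewrite /phi; case: pickP => [j /eqP|no]; last first.
    by have [j] := genQ g Pg; rewrite no.
  rewrite dg => /eqP; rewrite eq_expg_mod_order ot => /eqP e.
  exact/(natr_modp charF)/esym.
have phiM g h : g \in P -> h \in P -> phi (g * h)%g = phi g + phi h.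
  move=> Pg Ph; have [j /eqP dj] := genQ g Pg; have [k /eqP dk] := genQ h Ph.
  rewrite (phiE g j) // (phiE h k) // -natrD; apply: phiE; first exact: groupM.
  by rewrite morphM ?(subsetP nDP) //= dj dk expgD.
have phiD g : g \in D -> phi g = 0.
  move=> Dg; rewrite (phiE g 0%N) ?(subsetP sDP) //.
  by rewrite expg0 coset_id.
have phit (n : nat) : phi (t ^+ n)%g = n%:R.
  by apply: phiE; rewrite ?groupX // morphX ?(subsetP nDP).
have Dz : z \in D by apply: (subsetP (joing_subr _ _)); apply: cycle_id.
have phi_x0 g h : g \in P -> h \in P -> g x0 = h x0 -> phi g = phi h.
  move=> Pg Ph e; have PVh := groupVr Ph; have Pgh := groupM Pg PVh.
  have Sgh : (g * h^-1)%g \in S by rewrite memS // permM e permK.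
  have := phiD _ (subsetP (joing_subl _ _) _ Sgh).
  rewrite phiM // => /eqP; rewrite addr_eq0 => /eqP ->.
  have := phiM h h^-1%g Ph PVh; rewrite mulgV phiD ?group1 //.
  by move=> /eqP; rewrite eq_sym addrC addr_eq0 => /eqP ->; rewrite opprK.
pose v (x : F) : nat := xchoose (prime_field_natr charF cardF x).
have vK x : (v x)%:R = x.
  by symmetry; apply/eqP; apply: (xchooseP (prime_field_natr charF cardF x)).
have Ptz (m n : nat) : (t ^+ m * z ^+ n)%g \in P by rewrite groupM ?groupX.
have phitz m n : phi (t ^+ m * z ^+ n)%g = m%:R.
  by rewrite phiM ?groupX // phit phiD ?groupX // addr0.
pose e (u : F * F) : X := (t ^+ v u.1 * z ^+ v u.2)%g x0.
have ez b y (n : nat) : n%:R = y -> e (b, y) = (z ^+ n)%g ((t ^+ v b)%g x0).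
  by move=> ny; rewrite /e /= permM (expg_field (n := n) oz) // vK.
have inje : injective e.
  move=> [b y] [b' y'] eq_e.
  have eb : b = b'.
    by have := phi_x0 _ _ (Ptz _ _) (Ptz _ _) eq_e; rewrite !phitz !vK.
  rewrite -eb in eq_e *; congr (_, _).
  have [g Pg gx] := toX ((t ^+ v b)%g x0).
  move: eq_e; rewrite (ez b y _ (vK y)) (ez b y' _ (vK y')) -gx -!cPzX // =>
      /perm_inj eq_z.
  have /z_semireg : (z ^+ v y * (z ^+ v y')^-1)%g \in <[z]>%g.
    by rewrite groupM ?groupV ?mem_cycle.
  rewrite permM eq_z permK => /(_ erefl)/eqP;
      rewrite -eq_mulgV1 eq_expg_mod_order oz.
  by move/eqP/(natr_modp charF); rewrite !vK.
have bije : bijective e by apply: inj_card_bij => //; rewrite card_prod cardF cardX.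
have [e' eK e'K] := bije.
exists e, phi; split=> // [g Pg|tp b y].
  exists (fun b => (e' (g (e (b, 0)))).2) => b y.
  case E : (e' (g (e (b, 0)))) => [b' w] /=.
  have gE : g (e (b, 0)) = e (b', w) by rewrite -E e'K.
  have eb' : b + phi g = b'.
    have := phi_x0 (t ^+ v b * z ^+ v 0 * g)%g _ (groupM (Ptz _ _) Pg) (Ptz _ _).
    rewrite permM => /(_ _ _ gE).
    by rewrite phiM // !phitz !vK.
  rewrite -eb' in gE *.
  rewrite (ez (b + phi g) _ (v w + v y)%N); last by rewrite natrD !vK addrC.
  rewrite (ez b y (v y)) ?vK // cPzX // expgD permM -(ez _ w _ (vK w)).
  by rewrite -gE (ez b 0 0%N) // expg0 perm1.
have ot' : #[t]%g = p.
  apply/prime_nt_dvdP => //; last by rewrite order_dvdn tp.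
  by apply: contraNneq nDt => /eqP; rewrite order_eq1 => /eqP ->; apply: group1.
rewrite (ez b y (v y)) ?vK // (ez _ y (v y)) ?vK // cPzX //;
    congr ((fun_of_perm (z ^+ _)%g) _).
rewrite -permM -expgSr; congr (fun_of_perm _ x0); apply: (expg_field ot').
by rewrite vK -natr1 vK.
Qed.

End Coordinates.

(** * The two shapes of a transitive p-group cycle set *)

Section PGroupStage.

Variables (p : nat) (F : finFieldType).
Hypotheses (charF : p \in [pchar F]) (cardF : #|F| = p).
Variables (X : finType) (tau : X -> {perm X}).
Hypothesis cardX : #|X| = (p ^ 2)%N.
Let P : {group {perm X}} := <<[set tau x | x : X]>>%G.
Hypotheses (pP : p.-group P) (trP : [transitive P, on [set: X] | 'P]).
Hypothesis cyc : forall x y,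
  (tau x * tau (tau x y) = tau y * tau (tau y x))%g.

(** [f] is arbitrary here; [shift_like_cocycle] later splits it into a function of [b] and a
    function of [b - a]. *)
Definition shift_like (e : F * F -> X) (f : F -> F -> F) : Prop :=
  forall a x b y, tau (e (a, x)) (e (b, y)) = e (b + 1, y + f a b).

Definition even_like (e : F * F -> X) (Phi : F -> F) : Prop :=
  forall a x b y, tau (e (a, x)) (e (b, y)) = e (b + x, y + Phi (b - a)).

Definition pgroup_form : Prop := 
  exists e : F * F -> X, bijective e /\
   ((exists f, shift_like e f) \/
    (exists Phi, [/\ exists k, Phi k != Phi 0, forall k, Phi k = Phi (- k) &
                     even_like e Phi])).

Lemma mem_tau x : tau x \in P.
Proof. by rewrite mem_gen ?imset_f. Qed.

Lemma transitive_invariant (T : eqType) (I : X -> T) :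
  (forall u v, I (tau u v) = I v) -> forall u v, I u = I v.
Proof.
move=> Itau u v.
pose A := [set g : {perm X} | [forall x, I (g x) == I x]].
have gA : group_set A.
  apply/group_setP; split=> [|g h].
    by rewrite inE; apply/forallP=> x; rewrite perm1.
  rewrite !inE => /forallP Ig /forallP Ih; apply/forallP=> x.
  by rewrite permM (eqP (Ih _)).
have sPA : P \subset Group gA.
  rewrite gen_subG; apply/subsetP=> _ /imsetP[x _ ->].
  by rewrite inE; apply/forallP=> y; rewrite Itau.
have : u \in orbit 'P P v by rewrite (atransP trP) ?inE.
by case/orbitP=> g /(subsetP sPA); rewrite inE => /forallP/(_ v)/eqP <- <-.
Qed.

Lemma shift_like_rescale (e : F * F -> X) (f : F -> F -> F) (c : F) :
  bijective e -> c != 0 ->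
  (forall a x b y, tau (e (a, x)) (e (b, y)) = e (b + c, y + f a b)) ->
  exists e' f', bijective e' /\ shift_like e' f'.
Proof.
move=> bije c0 eE.
exists (fun u => e (c * u.1, u.2)), (fun a b => f (c * a) (c * b)); split.
  apply: (bij_comp bije); exists (fun u => (c^-1 * u.1, u.2)) => -[a x] /=.
    by rewrite mulKf.
  by rewrite mulVKf.
by move=> a x b y; rewrite eE /=; congr (e (_, _)); ring.
Qed.

(** If [s] or [s ^+ p] is a nontrivial element of [D], it translates fibres and
    [vertical_automorphism] applies. Otherwise [s] has order [p] modulo [D] and itself, so it can
    serve as [t], and [horizontal_automorphism] applies. *)
Lemma pgroup_stage (s : {perm X}) : s \in P -> s != 1%g ->
  (forall x, tau (s x) = (tau x ^ s)%g) ->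
  pgroup_form.
Proof.
have p_pr : prime p := pcharf_prime charF.
move=> Ps s1 autS.
have [D [nsDP iD coord]] := coordinates charF cardF cardX pP trP.
suff shiftA (e : F * F -> X) f c : bijective e -> c != 0 ->
    (forall a x b y, tau (e (a, x)) (e (b, y)) = e (b + c, y + f a b)) ->
  pgroup_form; last first.
  move=> be c0 eE; have [e' [f' [be' sl]]] := shift_like_rescale be c0 eE.
  by exists e'; split=> //; left; exists f'.
have autSX n x : tau ((s ^+ n)%g x) = (tau x ^ (s ^+ n))%g.
  elim: n x => [|n IHn] x; first by rewrite expg0 perm1 conjg1.
  by rewrite expgSr permM autS IHn conjgM.
have equations (e : F * F -> X) (phi : {perm X} -> F) : bijective e ->
  (forall g, g \in P -> exists w, forall b y, g (e (b, y)) = e (b + phi g,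
      y + w b)) ->
  exists f : F -> F -> F -> F, let c a x := phi (tau (e (a, x))) in
  [/\ forall a x b y, tau (e (a, x)) (e (b, y)) = e (b + c a x, y + f a x b),
      exists a x, c a x != 0,
      forall a x b y, c (b + c a x) (y + f a x b) + c a x
                    = c (a + c b y) (x + f b y a) + c b y &
      forall a x b y w, f (b + c a x) (y + f a x b) (w + c a x) + f a x w
                    = f (a + c b y) (x + f b y a) (w + c b y) + f b y w].
  case=> e' eK e'K act.
  pose f a x b := (e' (tau (e (a, x)) (e (b, 0)))).2.
  exists f => c.
  have E a x b y : tau (e (a, x)) (e (b, y)) = e (b + c a x, y + f a x b).
    have [w wE] := act _ (mem_tau (e (a, x))).
    by rewrite /f !wE eK add0r.
  have cyc' a x b y w :
    e (w + c a x + c (b + c a x) (y + f a x b),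
       0 + f a x w + f (b + c a x) (y + f a x b) (w + c a x))
    = e (w + c b y + c (a + c b y) (x + f b y a),
       0 + f b y w + f (a + c b y) (x + f b y a) (w + c b y)).
    have := congr1 (fun g : {perm X} => g (e (w, 0))) (cyc (e (a, x)) (e (b, y))).
    by rewrite /= !permM !E.
  split=> //.
  - have /existsP[u cu] : [exists u : F * F, c u.1 u.2 != 0].
      apply: contraT => /existsPn c0.
      have inv u v : (e' (tau u v)).1 = (e' v).1.
        rewrite -{1}(e'K u) -{1}(e'K v); case: (e' u) (e' v) => [a x] [b y].
        by rewrite E eK /=; have := c0 (a, x); rewrite negbK => /eqP /= ->;
            rewrite addr0.
      have := transitive_invariant inv (e (0, 0)) (e (1, 0)).
      by rewrite !eK => /eqP /=; rewrite eq_sym oner_eq0.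
    by exists u.1, u.2.
  - move=> a x b y; have := can_inj eK (cyc' a x b y 0) => -[e1 _].
    by move: e1; rewrite !add0r addrC => ->; rewrite addrC.
  - move=> a x b y w; have := can_inj eK (cyc' a x b y w) => -[_ e1].
    by move: e1; rewrite !add0r addrC => ->; rewrite addrC.
have vertical s0 : s0 \in D -> s0 != 1%g ->
    (forall x, tau (s0 x) = (tau x ^ s0)%g) ->
    pgroup_form.
  move=> Ds s01 autS0.
  have [t Pt nDt] : exists2 t, t \in P & t \notin D.
    apply/subsetPn; apply/negP; rewrite -indexg_eq1 iD => /eqP p1.
    by move: p_pr; rewrite p1.
  have [e [phi [be act phiD _]]] := coord t Pt nDt.
  have [f [E [a1 [x1 ca1]] eqc eqf]] := equations e phi be act.
  have [w wE] := act s0 (subsetP (normal_sub nsDP) s0 Ds).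
  rewrite (phiD _ Ds) in wE.
  have [e' eK e'K] := be.
  have [a0 wa0] : exists a0, w a0 != 0.
    apply/existsP; apply: contraT => /existsPn w0.
    case/negP: s01; apply/eqP/permP=> x; rewrite perm1 -[x]e'K; case: (e' x) => b y.
    by rewrite wE addr0; have := w0 b; rewrite negbK => /eqP ->; rewrite addr0.
  have cs a x b : e (b + phi (tau (e (a, x + w a))), w b + f a (x + w a) b)
      = e (b + phi (tau (e (a, x))), f a x b + w (b + phi (tau (e (a, x))))).
    have := congr1 (fun g : {perm X} => g (s0 (e (b, 0)))) (autS0 (e (a, x))).
    by rewrite /= permJ !wE !addr0 !E !wE !add0r addr0.
  have [c0 [f0 [c0n cE fE]]] := vertical_automorphism charF cardF eqc eqf wa0 ca1
    (fun a x => ltac:(have [/addrI] := can_inj eK (cs a x 0); done))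
    (fun a x b => ltac:(have [_] := can_inj eK (cs a x b);
                        rewrite addrC [X in _ = X]addrC; done)).
  by apply: (shiftA e f0 c0) => // a x b y; rewrite E cE fE.
have [Ds|nDs] := boolP (s \in D); first exact: (vertical s Ds s1 autS).
(* Powers of [s] are automorphisms as well, and [s ^+ p] lies in [D] because [P / D] has order
   [p]. *)
have [sp1|sp1] := eqVneq (s ^+ p)%g 1%g; last first.
  apply: (vertical (s ^+ p)%g _ sp1 (autSX p)).
  have nDP := normal_norm nsDP.
  apply: coset_idr; first by rewrite groupX ?(subsetP nDP).
  rewrite morphX ?(subsetP nDP) //= -iD -card_quotient //.
  by rewrite expg_cardG ?mem_quotient.
have [e [phi [be act _ /(_ sp1) sE]]] := coord s Ps nDs.
have [f [E [a1 [x1 ca1]] eqc eqf]] := equations e phi be act.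
have [e' eK e'K] := be.
have cs a x b : e (b + 1 + phi (tau (e (a + 1, x))), f (a + 1) x (b + 1))
      = e (b + phi (tau (e (a, x))) + 1, f a x b).
  have := congr1 (fun g : {perm X} => g (s (e (b, 0)))) (autS (e (a, x))).
  by rewrite /= permJ !sE !E !sE !add0r.
have [||Phi [fE lin]] := horizontal_automorphism charF cardF eqc eqf.
- by move=> a x; have [/eqP] := can_inj eK (cs a x 0);
    rewrite addrAC => /eqP/addIr/addrI.
- by move=> a x b; have [_] := can_inj eK (cs a x b).
(* If [Phi] vanished, the second coordinate would be invariant under every [tau u], against
   transitivity. *)
have /existsP exPhi : [exists k, Phi k != 0].
  apply: contraT => /existsPn Phi0.
  have inv u v : (e' (tau u v)).2 = (e' v).2.
    rewrite -{1}(e'K u) -{1}(e'K v); case: (e' u) (e' v) => [a x] [b y].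
    rewrite E eK fE /=; have := Phi0 (b - a); rewrite negbK => /eqP ->.
    by rewrite addr0.
  have := transitive_invariant inv (e (0, 0)) (e (0, 1)).
  by rewrite !eK => /eqP /=; rewrite eq_sym oner_eq0.
have [g [d [cE evenP]]] := lin exPhi.
have [g0|g0] := eqVneq g 0.
  apply: (shiftA e (fun a b => Phi (b - a)) d) => //.
    by move: ca1; rewrite cE g0 mul0r add0r.
  by move=> a x b y; rewrite E cE fE g0 mul0r add0r.
have {}evenP k : Phi k = Phi (- k) by apply: (mulfI g0).
(* For constant [Phi] the second coordinate moves by a nonzero constant, so exchanging the
   coordinates gives the shift-like form. *)
have [/forallP Pconst|] := boolP [forall k, Phi k == Phi 0].
  have Phi0 : Phi 0 != 0 by have [k] := exPhi; rewrite (eqP (Pconst k)).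
  apply: (shiftA (fun u => e (u.2, u.1)) (fun a b => g * a + d) (Phi 0)) => //.
    by apply: (bij_comp be); exists (fun u => (u.2, u.1)); case.
  by move=> a x b y /=; rewrite E cE fE (eqP (Pconst _)).
(* The new second coordinate is [g * x + d], so that the first coordinate moves by it exactly; this
   multiplies [Phi] by [g]. *)
case/forallPn=> k nk.
exists (fun u => e (u.1, (u.2 - d) / g)); split.
  by apply: (bij_comp be); exists (fun u => (u.1, g * u.2 + d)) => -[a x] /=;
    congr (_, _); field.
right; exists (fun k => g * Phi k); split.
- by exists k; apply: contraNneq nk => /(mulfI g0) ->.
- by move=> j; rewrite -evenP.
- by move=> a x b y /=; rewrite E cE fE; congr (e (_, _)); field.
Qed.

End PGroupStage.

(** * The complement of the Sylow p-subgroup *)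

(* The maps k normalise Q and act transitively, so all Q-orbits have the same
   size; it divides both |Q| and a power of p. *)
Lemma coprime_normalized_trivial (p k : nat) (gT : finGroupType) (Q : {group gT})
    (Y : finType) (r : gT -> Y -> Y) :
  prime p -> p^'.-group Q -> #|Y| = (p ^ k)%N ->
  (forall y, r 1%g y = y) ->
  (forall q q' y, q \in Q -> q' \in Q -> r (q * q')%g y = r q' (r q y)) ->
  (forall y y', exists h : Y -> Y, [/\ injective h, h y = y' &
     forall q, q \in Q -> exists2 q', q' \in Q & forall w,
         h (r q w) = r q' (h w)]) ->
  forall q y, q \in Q -> r q y = y.
Proof.
move=> p_pr p'Q cardY r1 rM trK q0 y0 Qq0.
have actP : is_action Q (fun y q => if q \in Q then r q y else y).
  split=> [q y y'|y q q' Qq Qq'] /=; last by rewrite groupM // Qq Qq' rM.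
  case: ifP => // Qq e.
  by rewrite -(r1 y) -(r1 y') -(mulgV q) !rM ?groupV // e.
pose to := Action actP.
pose n := #|orbit to Q y0|.
have le_orb y y' : (#|orbit to Q y| <= #|orbit to Q y'|)%N.
  have [h [h_inj <- hQ]] := trK y y'.
  rewrite -(card_imset _ h_inj); apply/subset_leq_card/subsetP=> _ /imsetP[w + ->].
  case/orbitP=> q Qq <-; have [q' Qq' hq] := hQ q Qq.
  by apply/orbitP; exists q'; rewrite // /= Qq Qq' hq.
have eq_orb y : #|orbit to Q y| = n by apply/eqP; rewrite eqn_leq !le_orb.
have acts : [acts Q, on [set: Y] | to].
  by apply/subsetP=> q Qq; rewrite inE Qq inE; apply/subsetP=> y; rewrite !inE.
have dvd_n : (n %| p ^ k)%N.
  rewrite -cardY -cardsT -(acts_sum_card_orbit acts).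
  by apply: dvdn_sum => _ /imsetP[y _ ->]; rewrite eq_orb.
have n1 : n = 1%N.
  have p'n : p^'.-nat n.
    by apply: pnat_dvd p'Q; rewrite /n card_orbit_in // dvdn_indexg.
  have pn : p.-nat n by apply: pnat_dvd dvd_n _; rewrite pnatX pnat_id.
  exact: (pnat_1 pn p'n).
have : r q0 y0 \in orbit to Q y0 by apply/orbitP; exists q0; rewrite //= Qq0.
by rewrite (card_orbit1 (etrans (eq_orb y0) n1)) => /set1P.
Qed.

(** * Groups of odd order on four points *)

Section OddOnFourPoints.

Variables (X : finType) (H : {group {perm X}}).
Hypotheses (cardX : #|X| = 4%N) (oddH : odd #|H|).

Lemma odd_orbit x : odd #|orbit 'P H x|.
Proof. by apply: dvdn_odd oddH; rewrite card_orbit dvdn_indexg. Qed.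

Lemma odd_fix_orbit x : (#|orbit 'P H x| <= 2)%N -> forall h, h \in H -> h x = x.
Proof.
move=> le2 h Hh; have := odd_orbit x.
have : (0 < #|orbit 'P H x|)%N by apply/card_gt0P; exists x; apply: orbit_refl.
case En : #|_| le2 => [|[|[|]]] //= _ _ _.
by have := mem_orbit 'P x Hh; rewrite (card_orbit1 En) => /set1P.
Qed.

(** Orbits have odd size, so an orbit of more than two points has three, and the remaining point is
    fixed. *)
Lemma odd_four_fixpoint : exists x, forall h, h \in H -> h x = x.
Proof.
have [x _] : exists x, x \in X by apply/card_gt0P; rewrite cardX.
have [le2|] := leqP #|orbit 'P H x| 2; first by exists x; apply: odd_fix_orbit.
have := max_card (mem (orbit 'P H x)); have := odd_orbit x; rewrite cardX.
case En : #|orbit 'P H x| => [|[|[|[|[|]]]]] //= _ _ _.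
have : (0 < #|~: orbit 'P H x|)%N by rewrite cardsCs setCK cardX En.
case/card_gt0P=> y; rewrite inE => nOy; exists y; apply: odd_fix_orbit.
rewrite ltnW // ltnS.
have sub : orbit 'P H y \subset ~: orbit 'P H x.
  apply/subsetP=> z; rewrite inE => Oz; apply: contra nOy => Oz'.
  by apply: orbit_trans Oz'; rewrite orbit_sym.
by apply: leq_trans (subset_leq_card sub) _; rewrite cardsCs setCK cardX En.
Qed.

Lemma odd_four_fix2 x y : x != y -> (forall h, h \in H -> h x = x) ->
  (forall h, h \in H -> h y = y) -> forall h z, h \in H -> h z = z.
Proof.
move=> xy fx fy h z; apply: odd_fix_orbit.
have [->|zx] := eqVneq z x.
  apply: leq_trans (_ : #|[set x]| <= 2)%N; last by rewrite cards1.
  by apply/subset_leq_card/subsetP=> _ /orbitP[g Hg <-]; rewrite inE /= /aperm fx.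
have [->|zy] := eqVneq z y.
  apply: leq_trans (_ : #|[set y]| <= 2)%N; last by rewrite cards1.
  by apply/subset_leq_card/subsetP=> _ /orbitP[g Hg <-]; rewrite inE /= /aperm fy.
apply: leq_trans (_ : #|~: [set x; y]| <= 2)%N;
    last by rewrite cardsCs setCK cardX cards2 xy.
apply/subset_leq_card/subsetP=> _ /orbitP[g Hg <-].
rewrite !inE /= /aperm -{1}(fx g Hg) -(fy g Hg) !(inj_eq perm_inj).
by rewrite negb_or zx zy.
Qed.

End OddOnFourPoints.

(** * The Sylow p-subgroup against its complement *)

Section PrimePart.

Variables (p : nat) (X : cycleSetType).
Hypotheses (p_pr : prime p) (cardX : #|X| = (p ^ 2)%N)
  (trG : [transitive permgrp X, on [set: X] | 'P]).

Implicit Types (x y z : X) (q g : {perm X}).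

Local Notation G := (permgrp X).
Local Notation tau := (part p).
Local Notation rho := (part p^').
Local Notation P := (bset_group X p).
Local Notation Q := (bset_group X p^').

Lemma trP : [transitive P, on [set: X] | 'P].
Proof. exact: sylow_transitive p_pr cardX trG (bset_Hall X p). Qed.

Lemma p'Q : p^'.-group Q. Proof. exact: pHall_pgroup (bset_Hall X p^'). Qed.

Lemma sPG : P \subset G. Proof. exact: bset_sub. Qed.
Lemma sQG : Q \subset G. Proof. exact: bset_sub. Qed.

Lemma tau_inG x : tau x \in G.
Proof. exact: subsetP sPG _ (part_in p x). Qed.

Lemma transP x y : exists2 g, g \in P & g x = y.
Proof.
have : y \in orbit 'P P x by rewrite (atransP trP) ?inE.
by case/orbitP=> g Pg <-; exists g.
Qed.

(** For such [q], [matchedP] says that the matched element is the conjugate by [tau u]. Hence these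
    [q] form a p'-group normalised by the transitive group [P]. *)
Lemma stable_tau_trivial q :
  q \in Q -> (forall x, tau (q x) = tau x) -> q = 1%g.
Proof.
pose A := [set q in Q | [forall x, tau (q x) == tau x]].
have gA : group_set A.
  apply/group_setP; split=> [|g h].
    by rewrite inE group1; apply/forallP=> x; rewrite perm1.
  rewrite !inE => /andP[Qg /forallP tg] /andP[Qh /forallP th].
  rewrite groupM //; apply/forallP=> x.
  by rewrite permM (eqP (th _)).
move=> Qq tq.
have Aq : q \in Group gA by rewrite inE Qq; apply/forallP=> x; rewrite tq.
have nAP : P \subset 'N(A).
  rewrite /= bset_gen gen_subG; apply/subsetP=> _ /imsetP[u _ ->].
  rewrite inE; apply/subsetP=> _ /imsetP[g Ag ->].
  move: Ag; rewrite !inE => /andP[Qg /forallP tg].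
  have := matchedP p u (subsetP sQG g Qg); rewrite (eqP (tg u)) => e.
  have -> : (g ^ tau u = matched (tau u) g)%g by rewrite conjgE e mulKg.
  rewrite matched_in ?tau_inG //=; apply/forallP=> x.
  have -> : matched (tau u) g = (g ^ tau u)%g by rewrite conjgE e mulKg.
  rewrite -[x in X in X == _](permKV (tau u)) permJ.
  rewrite (part_congr (w := (tau u)^-1%g x)) ?tau_inG //; first by rewrite permKV.
  exact/eqP/tg.
apply/permP=> x; rewrite perm1.
apply: (coprime_normalized_trivial (k := 2) (Q := Group gA) (r :=
    fun q x => q x) p_pr) => //.
- by apply: pgroupS p'Q; apply/subsetP=> g; rewrite inE => /andP[].
- by move=> y; rewrite perm1.
- by move=> g g' y _ _; rewrite permM.
move=> y y'; have [g Pg gy] := transP y y'.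
exists g; split=> //; first exact: perm_inj.
move=> h Ah; exists (h ^ g)%g => [|w]; last by rewrite permJ.
by rewrite memJ_norm // (subsetP nAP).
Qed.

Lemma tau_nontrivial x : tau x != 1%g.
Proof.
apply: contraTneq isT => tx.
have t1 y : tau y = 1%g.
  have [g Pg <-] := transP x y.
  rewrite (part_matched p x (subsetP sPG g Pg)) tx /matched.
  have -> : (subg G 1 : addgrp X) = 1%g.
    by apply: aperm_of_inj; rewrite aperm_subg.
  by rewrite lam_one ?(subsetP sPG).
have [y yx] : exists y, y != x.
  apply/existsP; apply: contraT => /existsPn eqx.
  have : (#|X| <= 1)%N.
    rewrite -cardsT -(cards1 x); apply/subset_leq_card/subsetP=> y _.
    by have := eqx y; rewrite negbK inE.
  by rewrite cardX leqNgt -{1}(exp1n 2) ltn_exp2r ?prime_gt1.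
have [g + gx] := transP x y; rewrite /= bset_gen => Pg.
have : g \in [1 {perm X}]%g.
  move: Pg; apply: subsetP; rewrite gen_subG.
  by apply/subsetP=> _ /imsetP[u _ ->]; rewrite t1 inE.
by move=> /set1P g1; move: yx; rewrite -gx g1 perm1 eqxx.
Qed.

Lemma rho_trivial x : rho x = 1%g -> forall y, rho y = 1%g.
Proof.
move=> rx y; have [g Pg <-] := transP x y.
rewrite (part_matched _ x (subsetP sPG g Pg)) rx /matched.
have -> : (subg G 1 : addgrp X) = 1%g by apply: aperm_of_inj; rewrite aperm_subg.
by rewrite lam_one ?(subsetP sPG).
Qed.

(** [Q] has odd order on four points and fixes some [x0]; there [matchedP] says that [tau x0]
    normalises [Q]. *)
Lemma two_rho_trivial : p = 2 -> forall x, rho x = 1%g.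
Proof.
move=> p2.
have oddQ : odd #|Q|.
  by have := p'Q; rewrite /pgroup p2 p'natE // dvdn2 negbK.
have card4 : #|X| = 4%N by rewrite cardX p2.
have [x0 fixQ] := odd_four_fixpoint card4 oddQ.
apply: (rho_trivial (x := x0)).
set t := tau x0; have Gt : t \in G := tau_inG x0.
have Qr : rho x0 \in Q := part_in _ x0.
have norm q : q \in Q -> (q ^ t = matched t q)%g.
  move=> Qq; have := matchedP p x0 (subsetP sQG q Qq); rewrite fixQ // => e.
  by rewrite conjgE e mulKg.
have nQt : t \in 'N(Q).
  rewrite inE; apply/subsetP=> _ /imsetP[q Qq ->].
  by rewrite norm // matched_in.
(* If [t] moves [x0], then [Q], being normalised by [t], fixes a second point and is trivial. *)
have [tx|tx] := eqVneq (t x0) x0; last first.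
  apply/permP=> z; rewrite perm1.
  apply: (odd_four_fix2 card4 oddQ tx) => // q Qq.
  by rewrite -(conjgKV t q) permJ fixQ // memJ_norm ?groupV.
have crt : commute (rho x0) t.
  apply/commgP/conjg_fixP; rewrite norm //.
  by rewrite -(part_matched _ x0 Gt) tx.
have oddr : odd #|<[rho x0]>%g|.
  by apply: dvdn_odd oddQ; apply: cardSg; rewrite cycle_subG.
have fixr h : h \in <[rho x0]>%g -> h x0 = x0.
  by move=> rh; apply: fixQ; apply: subsetP rh; rewrite cycle_subG.
have [/forallP r1|/forallPn[y ry]] := boolP [forall y, rho x0 y == y].
  by apply/permP=> y; rewrite perm1 (eqP (r1 y)).
have yx : y != x0 by apply: contraNneq ry => ->; rewrite fixQ.
have orb z : z != x0 -> exists2 h, h \in <[rho x0]>%g & h y = z.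
  move=> zx; suff : z \in orbit 'P <[rho x0]>%g y by case/orbitP=> h rh <-;
      exists h.
  have sub : orbit 'P <[rho x0]>%g y \subset ~: [set x0].
    apply/subsetP=> _ /orbitP[h rh <-]; rewrite !inE /= /aperm -(fixr h rh).
    by rewrite (inj_eq perm_inj).
  have : orbit 'P <[rho x0]>%g y == ~: [set x0].
    rewrite eqEcard sub cardsCs setCK card4 cards1 ltnNge.
    apply/negP=> le2; case/negP: ry; apply/eqP.
    by apply: (odd_fix_orbit oddr le2); apply: cycle_id.
  by move/eqP->; rewrite !inE.
have ty : t y != x0 by rewrite -{1}tx (inj_eq perm_inj).
have [h rh hy] := orb _ ty.
have tc g : g \in <[rho x0]>%g -> commute g t.
  by case/cycleP=> n ->; apply/commute_sym/commuteX/commute_sym.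
(* [t] commutes with [<[rho x0]>], which is transitive on the other three points, and agrees with
   [h] at [y]. So [t] lies in both [P] and [Q] and is 1, against [tau_nontrivial]. *)
have teq : t = h.
  apply/permP=> z; have [->|zx] := eqVneq z x0; first by rewrite tx fixr.
  have [g rg <-] := orb z zx.
  rewrite -!permM (tc g rg) permM -hy -permM.
  have : commute g h by case/cycleP: rg => i ->; case/cycleP: rh => j ->;
      apply: commuteX2.
  by move=> ->.
have : t \in P :&: Q.
  rewrite inE part_in teq /=; apply: subsetP rh; rewrite cycle_subG; exact: Qr.
have -> : (P :&: Q = 1)%g.
  apply: coprime_TIg; apply: pnat_coprime p'Q.
  exact: pHall_pgroup (bset_Hall X p).
by move/set1P=> t1; have := tau_nontrivial x0; rewrite -/t t1 eqxx.
Qed.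

End PrimePart.

(** * Translates of a function and parallelograms *)

Section EvenFunctions.

Variables (p : nat) (F : finFieldType).
Hypotheses (charF : p \in [pchar F]) (cardF : #|F| = p).

(** Otherwise [Phi] has the nonzero period [a - a'] and is constant. *)
Lemma shift_separated (Phi : F -> F) a a' :
  (exists k, Phi k != Phi 0) -> (forall b, Phi (b - a) = Phi (b - a')) -> a = a'.
Proof.
case=> k nk e; apply/eqP; rewrite -subr_eq0; apply: contraNT nk => aa'.
apply/eqP; apply: (shift_const charF cardF aa') => y.
have -> : y + (a - a') = y + a - a' by ring.
by rewrite -e addrK.
Qed.

(* The parallelogram relation: in the additive group of the permutation brace
   of an even cycle set, u + v = u' + v'. *)
Definition parallelogram (Phi : F -> F) (u v u' v' : F * F) : Prop :=
  u.2 + v.2 + Phi (v.1 - u.1) = u'.2 + v'.2 + Phi (v'.1 - u'.1) /\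
  forall b, Phi (b - u.1) + Phi (b - v.1) = Phi (b - u'.1) + Phi (b - v'.1).

(* If m did not preserve the fibres of the first projection, then some
   fibre would be mapped to points whose first coordinates exhaust F, making
   the translates of Phi' collinear. *)
Lemma parallelogram_fibres (Phi Phi' : F -> F) (m : F * F -> F * F) :
  p != 2%N -> injective m -> (exists k, Phi' k != Phi' 0) ->
  (forall k, Phi' k = Phi' (- k)) ->
  (forall u v u' v', parallelogram Phi u v u' v' ->
                     parallelogram Phi' (m u) (m v) (m u') (m v')) ->
  exists (r n : F -> F) (chi : F),
    chi != 0 /\ forall a x, m (a, x) = (r a, chi * x + n a).
Proof.
move=> p2 m_inj ncPhi evPhi mP.
(* Moving one unit of second coordinate from one point to the other preserves the sum. So the step
   from [x] to [x + 1] changes the translate of [Phi'] by the same function [w] at every point. *)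
have par0 a x a' x' : parallelogram Phi (a, x) (a', x' + 1) (a, x + 1) (a', x').
  by split=> //=; ring.
have step a x a' x' := mP _ _ _ _ (par0 a x a' x').
pose A a x := (m (a, x)).1; pose B a x := (m (a, x)).2.
have mE a x : m (a, x) = (A a x, B a x) by rewrite /A /B; case: (m _).
pose w b := Phi' (b - A 0 1) - Phi' (b - A 0 0).
have wE a x b : Phi' (b - A a (x + 1)) = Phi' (b - A a x) + w b.
  have [_ /(_ b)] := step a x 0 0; rewrite /= -!/(A _ _) add0r => e.
  apply: (addIr (Phi' (b - A 0 0))); rewrite -e /w; ring.
have [/forallP w0|/forallPn[b0 wb0]] := boolP [forall b, w b == 0].
  have rE a x : A a x = A a 0.
    apply: (shift_const charF cardF (h := A a) (oner_neq0 F)) => y.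
    apply: (shift_separated ncPhi) => b.
    by rewrite wE (eqP (w0 b)) addr0.
  pose chi := B 0 1 - B 0 0.
  have BE a x : B a (x + 1) = B a x + chi.
    have [+ _] := step a x 0 0; rewrite /= -!/(A _ _) -!/(B _ _) add0r.
    rewrite !(rE a (_ + _)) (rE a x) (rE 0 1) => /addIr e.
    by apply: (addIr (B 0 0)); rewrite -e /chi; ring.
  have BlinE a x : B a x = B a 0 + x * (chi / 1).
    exact: (shift_linear charF cardF (oner_neq0 F) (BE a)).
  exists (A^~ 0), (B^~ 0), chi; split; last first.
    by move=> a x; rewrite mE rE BlinE divr1 mulrC addrC.
  apply/eqP=> chi0; have := oner_neq0 F; case/eqP.
  have : m (0, 1) = m (0, 0).
    by rewrite !mE rE (BlinE 0 1) chi0 mul0r mulr0 addr0.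
  by move/m_inj => -[].
exfalso.
have lin x b : Phi' (b - A 0 x) = Phi' (b - A 0 0) + x * (w b / 1).
  exact: (shift_linear charF cardF (oner_neq0 F) (wE 0 ^~ b)).
have A_inj : injective (A 0).
  move=> x y eA; have := lin x b0; rewrite eA lin => /addrI.
  by rewrite divr1 => /(mulIf wb0).
have [A' _ A'K] : bijective (A 0) by apply: injF_bij.
have colin k : exists t, forall b, Phi' (b - k) = Phi' b + t * w b.
  exists (A' k - A' 0) => b.
  have := lin (A' k) b; have := lin (A' 0) b; rewrite !A'K subr0 => -> ->.
  by rewrite !divr1; ring.
have wz : w 0 != 0.
  have [k] := ncPhi; apply: contraNneq => w00.
  have [t tE] := colin (- k); have := tE 0.
  by rewrite sub0r opprK w00 mulr0 addr0 => ->.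
(* The translates by [k] and [- k] lie on the line through [Phi'] with direction [w] and agree at 0
   by evenness, so they coincide. *)
have sym (k : F) : k = - k.
  have [t tE] := colin k; have [t' t'E] := colin (- k).
  apply: (shift_separated ncPhi) => b; rewrite tE t'E; congr (_ + _ * _).
  apply: (mulIf wz); apply: (addrI (Phi' 0)).
  by rewrite -tE -t'E !sub0r evPhi.
have : 2%:R != 0 :> F.
  by rewrite -(dvdn_pcharf charF) dvdn_prime2 // (pcharf_prime charF).
by case/eqP; rewrite mulr2n {1}(sym 1) addNr.
Qed.

End EvenFunctions.

Lemma indecomposable_transitive (X : cycleSetType) :
  (0 < #|X|)%N -> indecomposable X -> [transitive permgrp X, on [set: X] | 'P].
Proof.
case/card_gt0P=> x0 _ indec.
pose A := orbit 'P (permgrp X) x0.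
have clA x y : (cdot x y \in A) = (y \in A).
  by rewrite -sigmaE -(orbit_actr 'P x0 y (mem_sigma x)).
apply/imsetP; exists x0; rewrite ?inE //; symmetry; apply/eqP.
apply: contraT => nA; case: indec; exists A, (~: A); split; last first.
  by split=> x y _; rewrite ?inE clA // inE.
split.
- by apply/set0Pn; exists x0; apply: orbit_refl.
- by apply: contra nA => /eqP A0; rewrite -[orbit _ _ _]setCK A0 setC0.
- exact: setUCr.
- by rewrite -setI_eq0 setICr.
Qed.

(** * The complement in the shift-like and even-like cases *)

Section PrimeComplement.

Variables (p : nat) (F : finFieldType).
Hypotheses (charF : p \in [pchar F]) (cardF : #|F| = p).
Variable X : cycleSetType.
Hypotheses (cardX : #|X| = (p ^ 2)%N)
  (trG : [transitive permgrp X, on [set: X] | 'P]).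

Local Notation tau := (part p).
Local Notation rho := (part p^').
Local Notation P := (bset_group X p).
Local Notation Q := (bset_group X p^').

Let p_pr : prime p := pcharf_prime charF.
Let GQ q : q \in Q -> q \in permgrp X := subsetP (sQG p X) q.

(** The order of [q] is prime to [p], yet that many shifts by [d] add up to 0. *)
Lemma coprime_shift_trivial q (I : X -> F) d :
  q \in Q -> (forall u, I (q u) = I u + d) -> d = 0.
Proof.
move=> Qq IE.
have IX j u : I ((q ^+ j)%g u) = I u + j%:R * d.
  elim: j u => [|j IHj] u; first by rewrite expg0 perm1 mul0r addr0.
  by rewrite expgSr permM IE IHj mulrSr; ring.
have [u _] : exists u, u \in X by apply/card_gt0P; rewrite cardX expn_gt0 prime_gt0.
have := IX #[q]%g u; rewrite expg_order perm1 -[LHS]addr0 => /addrI/esym/eqP.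
rewrite mulf_eq0 -(dvdn_pcharf charF) => /orP[|/eqP //].
by have := mem_p_elt (p'Q p X) Qq; rewrite /p_elt p'natE // => /negbTE->.
Qed.

Lemma splitting_pgroup_form : pgroup_form F (part p (X := X)).
Proof.
have ntP : bset X p != 1%g.
  have [x _] : exists x, x \in X.
    by apply/card_gt0P; rewrite cardX expn_gt0 prime_gt0.
  apply: contraNneq (tau_nontrivial p_pr cardX trG x) => P1.
  by have := part_in p x; rewrite P1 inE.
have [s [Ps s1 autS]] := part_automorphism p_pr ntP.
apply: (pgroup_stage charF cardF cardX _ _ _ _ s1 autS).
- rewrite /= -bset_gen; exact: pHall_pgroup (bset_Hall X p).
- rewrite /= -bset_gen; exact: trP.
- exact: part_cycle.
- by rewrite /= -bset_gen.
Qed.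

(** By the cycle set equation the increment of [f] along the diagonal does not depend on its first
    argument. So [f a b - f b b] is invariant under diagonal translation and depends on [b - a]
    only. *)
Lemma shift_like_cocycle (e : F * F -> X) f :
  bijective e -> shift_like tau e f ->
  exists (h Phi : F -> F), Phi 0 = 0 /\ forall a b, f a b = h b + Phi (b - a).
Proof.
case=> e' eK _ eE.
have key a b w : f (b + 1) (w + 1) + f a w = f (a + 1) (w + 1) + f b w.
  have := congr1 (fun g :
      {perm X} => g (e (w, 0))) (part_cycle p (e (a, 0)) (e (b, 0))).
  by rewrite /= !permM !eE => /(can_inj eK)[]; rewrite !add0r addrC => ->;
      rewrite addrC.
exists (fun b => f b b), (fun k => f 0 k - f k k); split=> [|a b];
    first exact: subrr.
pose h t := f (a + t) (b + t) - f (b + t) (b + t).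
have hE t : h (t + 1) = h t.
  rewrite /h !addrA; have := key (a + t) (b + t) (b + t) => e1.
  have -> : f (a + t + 1) (b + t + 1) = f (b + t + 1) (b + t + 1) + f (a + t)
      (b + t) - f (b + t) (b + t).
    by rewrite e1 addrK.
  by ring.
have := shift_const charF cardF (oner_neq0 F) hE (- a).
by rewrite /h subrr !addr0 => ->; ring.
Qed.

(** For nonconstant [Phi], [tau u] and the first coordinate of [u] determine each other, so [Q]
    permutes the fibres; for constant [Phi] all [tau u] coincide. Both cases end with
    [stable_tau_trivial]. *)
Lemma shift_like_coprime_trivial (e : F * F -> X) f :
  bijective e -> shift_like tau e f -> forall q, q \in Q -> q = 1%g.
Proof.
move=> be eE q0 Qq0; have [h [Phi [Phi0 fE]]] := shift_like_cocycle be eE.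
have [e' eK e'K] := be.
have tau_fst u v : (e' u).1 = (e' v).1 -> tau u = tau v.
  rewrite -{2}(e'K u) -{2}(e'K v); case: (e' u) (e' v) => [a x] [a' y] /= <-.
  by apply/permP=> z; rewrite -(e'K z); case: (e' z) => b w; rewrite !eE.
apply: (stable_tau_trivial p_pr cardX trG) => //.
have [/forallP Pconst|/forallPn ncPhi] := boolP [forall k, Phi k == Phi 0].
  suff tau_const (u v : X) : tau u = tau v by move=> u; apply: tau_const.
  rewrite -(e'K u) -(e'K v); case: (e' u) (e' v) => [a x] [a' y].
  apply/permP=> z; rewrite -(e'K z); case: (e' z) => b w.
  by rewrite !eE !fE (eqP (Pconst (b - a))) (eqP (Pconst (b - a'))).
have fst_tau u v : tau u = tau v -> (e' u).1 = (e' v).1.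
  rewrite -{1}(e'K u) -{1}(e'K v); case: (e' u) (e' v) => [a x] [a' y] /= eqt.
  apply: (shift_separated charF cardF ncPhi) => b.
  have := congr1 (fun g : {perm X} => g (e (b, 0))) eqt.
  by rewrite /= !eE !fE => /(can_inj eK)[/addrI/addrI].
pose r q a := (e' (q (e (a, 0)))).1.
have rE q u : q \in Q -> (e' (q u)).1 = r q (e' u).1.
  move=> Qq; apply: fst_tau; apply: part_congr; first exact: GQ.
  by apply: tau_fst; rewrite eK.
have r_step q : q \in Q ->
    exists2 q', q' \in Q & forall w, r q w + 1 = r q' (w + 1).
  move=> Qq; have Gt := tau_inG p (e (0, 0)).
  exists (matched (tau (e (0, 0))) q) => [|w]; first exact: matched_in.
  have := congr1 (fun g : {perm X} => g (e (w, 0))) (matchedP p (e (0, 0)) (GQ Qq)).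
  rewrite /= !permM eE => /(congr1 (fun u => (e' u).1)).
  rewrite [RHS]rE ?matched_in // eK /= => <-.
  rewrite -[q (e (w, 0))]e'K -[q (e (0, 0))]e'K /r.
  by case: (e' _) (e' _) => [a x] [b y]; rewrite eE !eK.
(* By [r_step], iterated, the translations of [F] normalise the action of [Q] on the [p] fibres, and
   they are transitive. *)
have r_triv q a : q \in Q -> r q a = a.
  move: q a; apply: (coprime_normalized_trivial (k := 1) p_pr (p'Q p X)).
  - by rewrite cardF expn1.
  - by move=> a; rewrite /r perm1 eK.
  - by move=> q q' a Qq Qq'; rewrite /r permM [LHS]rE.
  move=> y y'; exists (fun x => x + (y' - y)); split.
  - exact: addIr.
  - by rewrite addrC subrK.
  have [n /eqP ->] := prime_field_natr charF cardF (y' - y).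
  elim: (nat_of_ord n) => [|j IHj] q Qq; first by exists q => // w; rewrite !addr0.
  have [q1 Qq1 q1E] := IHj q Qq; have [q2 Qq2 q2E] := r_step q1 Qq1.
  by exists q2 => // w; rewrite mulrSr !addrA q1E q2E.
by move=> u; apply: tau_fst; rewrite rE // r_triv.
Qed.

(** For odd [p], [Q] respects parallelograms, so its elements are affine on fibres with a common
    slope [chi]. Those of slope 1 form the centraliser [Q1] of the fibre translation [z], which is
    shown to be trivial. Hence [matched] fixes [Q] and [rho] takes one value [g]; [matchedP] for [g]
    gives the remaining relations. *)
Lemma even_like_structure (e : F * F -> X) Phi :
  bijective e -> even_like tau e Phi ->
  (exists k, Phi k != Phi 0) -> (forall k, Phi k = Phi (- k)) ->
  exists (chi r0 : F) (g : {perm X}),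
    [/\ chi != 0, g \in Q, forall x, sigma x = (tau x * g)%g,
        forall b y, g (e (b, y)) = e (chi * b + r0, chi * y) &
        forall k, Phi (chi * k) = chi * Phi k].
Proof.
move=> be eE ncPhi evPhi; have [e' eK e'K] := be.
have [p2|p2] := eqVneq p 2%N.
  exists 1, 0, 1%g; split=> //.
  - exact: oner_neq0.
  - by move=> x; rewrite mulg1 (sigma_split p) (two_rho_trivial p_pr) // mulg1.
  - by move=> b y; rewrite perm1 !mul1r addr0.
  - by move=> k; rewrite !mul1r.
have tauE u v : tau (e u) (e v) = e (v.1 + u.2, v.2 + Phi (v.1 - u.1)).
  by case: u v => [a x] [b y]; rewrite eE.
have parE u v u' v' :
    (tau (e u) * tau (tau (e u) (e v)) = tau (e u') * tau (tau (e u') (e v')))%g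
    <-> parallelogram Phi u v u' v'.
  have E u0 v0 w : (tau (e u0) * tau (tau (e u0) (e v0)))%g (e w)
      = e (w.1 + (u0.2 + v0.2 + Phi (v0.1 - u0.1)),
           w.2 + (Phi (w.1 - u0.1) + Phi (w.1 - v0.1))).
    rewrite permM !tauE /=; congr (e (_, _)); first by ring.
    by rewrite -addrA; congr (_ + (_ + Phi _)); ring.
  split=> [eqt|[e1 e2]].
    have eqw w := congr1 (fun g : {perm X} => g (e w)) eqt; rewrite /= in eqw.
    split=> [|b]; first by have := eqw (0, 0); rewrite !E => /(can_inj eK)[/addrI].
    by have := eqw (b, 0); rewrite !E => /(can_inj eK)[_ /addrI].
  by apply/permP=> z; rewrite -(e'K z) !E e1 e2.
have affine q : q \in Q -> exists (r n : F -> F) (chi : F),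
    chi != 0 /\ forall a x, q (e (a, x)) = e (r a, chi * x + n a).
  move=> Qq; pose m u := e' (q (e u)).
  have m_inj : injective m.
    exact: inj_comp (can_inj e'K) (inj_comp perm_inj (can_inj eK)).
  have mP u v u' v' : parallelogram Phi u v u' v' ->
      parallelogram Phi (m u) (m v) (m u') (m v').
    by move/parE=> eqt; apply/parE; rewrite /m !e'K; apply: part_par eqt; apply: GQ.
  have [r [n [chi [chi0 mE]]]] :=
    parallelogram_fibres charF cardF p2 m_inj ncPhi evPhi mP.
  by exists r, n, chi; split=> // a x; rewrite -mE e'K.
have matchE q r n chi a x : q \in Q ->
    (forall a x, q (e (a, x)) = e (r a, chi * x + n a)) ->
    exists (r' n' : F -> F), let q' := matched (tau (e (a, x))) q in
    [/\ q' \in Q, forall b y, q' (e (b, y)) = e (r' b, chi * y + n' b),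
        forall b, r' (b + x) = r b + (chi * x + n a) &
        forall b, chi * Phi (b - a) + n' (b + x) = n b + Phi (r b - r a)].
  move=> Qq qE; have Gt := tau_inG p (e (a, x)).
  have Qq' : matched (tau (e (a, x))) q \in Q := matched_in Gt Qq.
  have [r' [n' [chi' [_ q'E]]]] := affine _ Qq'.
  have M b y : e (r b + (chi * x + n a), chi * y + n b + Phi (r b - r a))
             = e (r' (b + x), chi' * (y + Phi (b - a)) + n' (b + x)).
    have := congr1 (fun g :
        {perm X} => g (e (b, y))) (matchedP p (e (a, x)) (GQ Qq)).
    by rewrite /= !permM !qE !eE q'E.
  have M2 b y : chi * y + n b + Phi (r b - r a)
              = chi' * (y + Phi (b - a)) + n' (b + x).
    by have /(can_inj eK)[_] := M b y.
  have eqchi : chi' = chi.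
    have := congr2 (fun s t => s - t) (M2 0 1) (M2 0 0).
    set L := _ - _; set R := _ - _ => LR.
    have -> : chi' = R by rewrite /R; ring.
    by rewrite -LR /L; ring.
  exists r', n'; split=> // [b y|b|b]; first by rewrite q'E eqchi.
    by have /(can_inj eK)[] := M b 0.
  by have := M2 b 0; rewrite eqchi mulr0 !add0r.
pose zf (u : X) := e ((e' u).1, (e' u).2 + 1).
have zf_inj : injective zf.
  move=> u v /(can_inj eK)[e1 /addIr e2]; apply: (can_inj e'K).
  by case: (e' u) (e' v) e1 e2 => [a x] [b y] /= -> ->.
pose z : {perm X} := perm zf_inj.
have zE a x : z (e (a, x)) = e (a, x + 1) by rewrite permE /zf eK.
pose Q1 := 'C_Q[z]%G.
have Q1E q : q \in Q -> (forall u, q (z u) = z (q u)) -> q \in Q1.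
  move=> Qq qz; rewrite inE Qq; apply/cent1P; apply/permP=> u.
  by rewrite !permM qz.
have affine1 q : q \in Q1 -> exists r n : F -> F,
    forall a x, q (e (a, x)) = e (r a, x + n a).
  case/setIP=> Qq /cent1P cqz; have [r [n [chi [_ qE]]]] := affine q Qq.
  have := congr1 (fun g : {perm X} => g (e (0, 0))) cqz.
  rewrite /= !permM zE !qE zE => /(can_inj eK)[e1].
  have chi1 : chi = 1 by apply: (addIr (n 0)); move: e1;
      rewrite mulr0 !add0r mulr1 addrC [1 + _]addrC.
  by exists r, n => a x; rewrite qE chi1 mul1r.
have matched1 q (a x : F) : q \in Q1 -> exists r : F -> F,
    (forall a x, q (e (a, x)) = e (r a, x)) /\
    exists2 q', q' \in Q1 & exists r', 
    (forall b y, (e' (q' (e (b, y)))).1 = r' b) /\ forall b, r' (b + x) = r b + x.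
  move=> Q1q; have [r [n qE]] := affine1 q Q1q.
  have Qq : q \in Q by case/setIP: Q1q.
  have qE1 b y : q (e (b, y)) = e (r b, 1 * y + n b) by rewrite qE mul1r.
  (* The match of [q] at [e (c, 0)], composed with [q^-1], is an element of [Q] that shifts the
     first coordinate by [n c]. *)
  have n0 c : n c = 0.
    have [r' [n' [Qq' q'E rr' _]]] := matchE _ _ _ _ c 0 Qq qE1.
    apply: (coprime_shift_trivial (q := (q^-1 * matched (tau (e (c, 0))) q)%g)
              (I := fun u => (e' u).1)) => [|u].
      by rewrite groupM ?groupV.
    have [v ->] : exists v, u = q v by exists ((q^-1)%g u); rewrite permKV.
    rewrite permM permK -(e'K v); case: (e' v) => b y.
    by rewrite q'E qE !eK /=; have := rr' b; rewrite addr0 mulr0 add0r.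
  exists r; split=> [b y|]; first by rewrite qE n0 addr0.
  have [r' [n' [Qq' q'E rr' _]]] := matchE _ _ _ _ a x Qq qE1.
  exists (matched (tau (e (a, x))) q); last first.
    exists r'; split=> b; first by move=> y; rewrite q'E eK.
    by rewrite rr' mul1r n0 addr0.
  apply: Q1E => // u; rewrite -(e'K u); case: (e' u) => b y.
  by rewrite zE !q'E zE; congr (e (_, _)); ring.
have Q1triv q : q \in Q1 -> q = 1%g.
  move=> Q1q; have [r [qE _]] := matched1 q 0 0 Q1q.
  pose rr g a := (e' (g (e (a, 0)))).1 : F.
  have fst1 g b y : g \in Q1 -> (e' (g (e (b, y)))).1 = rr g b.
    by move=> /(matched1 _ 0 0)[r1 [gE _]]; rewrite /rr !gE !eK.
  have r_triv g a : g \in Q1 -> rr g a = a.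
    move: g a; apply: (coprime_normalized_trivial (k := 1) (Q := Q1) p_pr).
    - by apply: pgroupS (p'Q p X); apply: subsetIl.
    - by rewrite cardF expn1.
    - by move=> a; rewrite /rr perm1 eK.
    - move=> g g' a Q1g Q1g'.
      have := fst1 g' (e' (g (e (a, 0)))).1 (e' (g (e (a, 0)))).2 Q1g'.
      by rewrite -surjective_pairing e'K /rr permM.
    move=> b b'; exists (fun y => y + (b' - b)); split.
    - exact: addIr.
    - by rewrite addrC subrK.
    move=> g Q1g; have [r1 [gE [g' Q1g' [r' [g'E rr']]]]] :=
        matched1 g 0 (b' - b) Q1g.
    by exists g' => // w; rewrite /rr gE eK g'E rr'.
  apply/permP=> u; rewrite perm1 -(e'K u); case: (e' u) => a x.
  by rewrite qE; congr (e (_, _)); have := r_triv q a Q1q; rewrite /rr qE eK.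
(* [q] and its match have the same slope, so their quotient commutes with [z] and lies in the
   trivial group [Q1]. *)
have matched_id q u : q \in Q -> matched (tau u) q = q.
  move=> Qq; have [r [n [chi [chi0 qE]]]] := affine q Qq.
  rewrite -(e'K u); case: (e' u) => a x.
  have [r' [n' [Qq' q'E _ _]]] := matchE _ _ _ _ a x Qq qE.
  set q' := matched _ q in Qq' q'E *.
  suff /Q1triv/eqP : (q^-1 * q')%g \in Q1 by rewrite -eq_mulVg1 => /eqP.
  apply: Q1E; first by rewrite groupM ?groupV.
  move=> v; have [w ->] : exists w, v = q w by exists ((q^-1)%g v); rewrite permKV.
  rewrite -(e'K w); case: (e' w) => b y.
  have -> : z (q (e (b, y))) = q (e (b, y + chi^-1)).
    by rewrite !qE zE; congr (e (_, _)); rewrite mulrDr mulfV //; ring.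
  rewrite !permM !permK !q'E zE; congr (e (_, _)); rewrite mulrDr mulfV //; ring.
have [u0 _] : exists u0, u0 \in X by apply/card_gt0P;
    rewrite cardX expn_gt0 prime_gt0.
pose g := rho u0; have Qg : g \in Q := part_in _ u0.
have rhoE u : rho u = g.
  have inv (u' v : X) : rho (tau u' v) = rho v.
    rewrite (part_matched _ v (tau_inG p u')).
    by rewrite matched_id ?part_in.
  have trP' : [transitive <<[set tau x | x : X]>>%G, on [set: X] | 'P].
    by rewrite /= -bset_gen; apply: trP.
  exact: (transitive_invariant trP' inv).
have [r [n [chi [chi0 gE]]]] := affine g Qg.
have gM a x b y : (r b + (chi * x + n a) = r (b + x)) /\
    (chi * y + n b + Phi (r b - r a) = chi * (y + Phi (b - a)) + n (b + x)).
  have := congr1 (fun h : {perm X} => h (e (b, y))) (matchedP p (e (a, x)) (GQ Qg)).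
  by rewrite matched_id // /= !permM !gE !eE gE => /(can_inj eK)[].
have n0 a : n a = 0.
  by have [+ _] := gM a 0 0 0; rewrite mulr0 add0r addr0 => /eqP;
      rewrite -[r 0 in X in _ == X]addr0 => /eqP/addrI.
have rE b : r b = chi * b + r 0.
  by have [+ _] := gM 0 b 0 0; rewrite n0 add0r addr0 => <-; ring.
exists chi, (r 0), g; split=> //.
- by move=> x; rewrite (sigma_split p x) rhoE.
- by move=> b y; rewrite gE rE n0 addr0.
- move=> k; have [_] := gM 0 0 k 0; rewrite !n0 !addr0 mulr0 !add0r subr0 => <-.
  by rewrite (rE k) addrK.
Qed.

End PrimeComplement.

(** * Parameters and isomorphism classes *)

Section IsomorphismInvariants.

Variables (p : nat) (F : finFieldType).
Hypotheses (charF : p \in [pchar F]) (cardF : #|F| = p).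

(** This and [even_op] are the operations of the last two families over any field with [p] elements;
    [shift_cdotE] and [even_cdotE] make the link. *)
Definition shift_op (S : F) (Phi : F -> F) (u v : F * F) : F * F :=
  (v.1 + 1, v.2 + (if v.1 == 0 then 1 else 0) * S + Phi (v.1 - u.1)).

Definition even_op (alpha : F) (Phi : F -> F) (u v : F * F) : F * F :=
  (alpha * v.1 + alpha * u.2, alpha * v.2 + alpha * Phi (v.1 - u.1)).

(** [mu] is given by the partial sums of [k], which are periodic modulo [p] because the total
    vanishes. *)
Lemma cyclic_primitive (k : F -> F) : \sum_(i < p) k i%:R = 0 ->
  exists mu, forall x, mu (x + 1) = mu x + k x.
Proof.
move=> sum0; pose T n := \sum_(i < n) k i%:R.
have T_period n : T (p + n)%N = T n.
  rewrite /T big_split_ord /= sum0 add0r; apply: eq_bigr => i _.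
  by rewrite natrD (pcharf0 charF) add0r.
have T_mod n : T n = T (n %% p)%N.
  rewrite {1}(divn_eq n p); elim: (n %/ p)%N => // j IHj.
  by rewrite mulSn -addnA T_period.
pose v (x : F) : nat := xchoose (prime_field_natr charF cardF x).
have vK x : x = (v x)%:R by apply/eqP;
    apply: (xchooseP (prime_field_natr charF cardF x)).
have T_natr m n : m%:R = n%:R :> F -> T m = T n.
  by move=> /(natr_modp charF) e; rewrite (T_mod m) (T_mod n) e.
exists (fun x => T (v x)) => x.
rewrite (T_natr _ (v x).+1); last by rewrite -vK -natr1 -vK.
by rewrite /T big_ord_recr /= -vK.
Qed.

Lemma sum_chi (S c : F) : \sum_(b : F) (if c + b == 0 then 1 else 0) * S = S.
Proof.
rewrite (bigD1 (- c)) //= subrr eqxx mul1r big1 ?addr0 // => b.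
by rewrite -addr_eq0 addrC => /negbTE ->; rewrite mul0r.
Qed.

(** Elements with equal first coordinates act alike, so [m] preserves fibres, and it translates
    their index. Comparing different acting elements shows that [m] is affine on fibres with slope
    [alpha]. *)
Lemma shift_iso_params (S S' : F) (Phi Phi' : F -> F) (m : F * F -> F * F) :
  bijective m -> {morph m : u v / shift_op S Phi u v >-> shift_op S' Phi' u v} ->
  Phi 0 = 0 -> Phi' 0 = 0 -> (exists k, Phi k != Phi 0) ->
      (exists k, Phi' k != Phi' 0) ->
  exists alpha, [/\ alpha != 0, alpha * S = S' & forall x, alpha * Phi x = Phi' x].
Proof.
case=> m' mK m'K mM Phi0 Phi0' [k0 nk0] ncPhi'.
have [k1 nk1] := ncPhi'.
pose r a := (m (a, 0)).1; pose g b y := (m (b, y)).2.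
have mE a x : m (a, x) = (r a, g a x).
  rewrite [LHS]surjective_pairing; congr (_, _).
  apply: (shift_separated charF cardF ncPhi') => b.
  have [[b1 y1] <-] : exists u, (m u).1 = b by exists (m' (b, 0)); rewrite m'K.
  have := mM (a, x) (b1, y1); have := mM (a, 0) (b1, y1);
      rewrite /shift_op /= => -> [].
  by move/addrI.
have rM b : r (b + 1) = r b + 1.
  by have := mM (0, 0) (b, 0); rewrite /shift_op /= !mE /= => -[].
have rE b : r b = r 0 + b.
  have := shift_linear charF cardF (oner_neq0 F) rM b.
  by rewrite divr1 mulr1.
pose ch (b : F) : F := if b == 0 then 1 else 0.
have gM a b y : g (b + 1) (y + ch b * S + Phi (b - a))
              = g b y + ch (r b) * S' + Phi' (b - a).
  have := mM (a, 0) (b, y); rewrite /shift_op /= !mE /= => -[_ ->].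
  by have -> : r b - r a = b - a by rewrite (rE b) (rE a); ring.
have gM0 b y : g (b + 1) (y + ch b * S) = g b y + ch (r b) * S'.
  by have := gM b b y; rewrite subrr Phi0 Phi0' !addr0.
have gPhi b y k : g b (y + Phi k) = g b y + Phi' k.
  have := gM (b - 1 - k) (b - 1) (y - ch (b - 1) * S).
  by rewrite -gM0 !subrK => e; rewrite -[k in RHS](subKr (b - 1)) -e;
      congr (g b (_ + Phi _)); ring.
have nz : Phi k0 != 0 by rewrite -Phi0.
pose alpha := Phi' k0 / Phi k0.
have glin b y : g b y = g b 0 + y * alpha.
  exact: (shift_linear charF cardF (h := g b) nz (fun y => gPhi b y k0)).
have alphaPhi x : alpha * Phi x = Phi' x.
  by have := gPhi 0 0 x; rewrite add0r glin => /addrI <-; rewrite mulrC.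
exists alpha; split=> //.
  apply: contraNneq nk1 => a0.
  by rewrite -!alphaPhi a0 !mul0r.
have step b : g (b + 1) 0 + alpha * (ch (0 + b) * S) = g b 0 + ch (r 0 + b) * S'.
  by rewrite -rE -gM0 !add0r (glin (b + 1) (ch b * S)) mulrC.
(* Summed over the whole cycle, the values of [g] cancel, and only [alpha * S] and [S'] remain. *)
have : \sum_(b : F) (g (b + 1) 0 + alpha * (ch (0 + b) * S))
     = \sum_(b : F) (g b 0 + ch (r 0 + b) * S') by apply: eq_bigr => b _.
rewrite !big_split /= -big_distrr /= !sum_chi.
have -> : \sum_(b : F) g (b + 1) 0 = \sum_(b : F) g b 0.
  by rewrite [RHS](reindex_inj (addIr (1 : F))).
by move/addrI.
Qed.

(** For odd [p], [m] preserves parallelograms, hence is affine on fibres with one slope [chi], and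
    [beta] is its inverse. For [p = 2] both unit parameters are 1. *)
Lemma even_iso_params (alpha alpha' : F) (Phi Phi' : F -> F) (m : F * F -> F * F) :
  bijective m -> {morph m :
      u v / even_op alpha Phi u v >-> even_op alpha' Phi' u v} ->
  alpha != 0 -> alpha' != 0 ->
  (exists k, Phi k != Phi 0) -> (exists k, Phi' k != Phi' 0) ->
  (forall k, Phi' k = Phi' (- k)) ->
  (forall k, Phi (alpha * k) = alpha * Phi k) ->
  (forall k, Phi' (alpha' * k) = alpha' * Phi' k) ->
  alpha = alpha' /\
  exists beta, beta != 0 /\ forall x, beta^-1 * Phi (beta * x) = Phi' x.
Proof.
move=> bm mM a0 a0' ncPhi ncPhi' evPhi' PhiM PhiM'.
have [m' mK m'K] := bm.
have [p2|p2] := eqVneq p 2%N.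
  have F2 (x : F) : (x == 0) || (x == 1).
    have [i /eqP ->] := prime_field_natr charF cardF x; case: i => i /=.
    by rewrite p2; case: i => [|[|]] //= _; rewrite ?mulr0n ?mulr1n ?eqxx ?orbT.
  have unit1 (x : F) : x != 0 -> x = 1 by move=> /negbTE x0; have := F2 x;
      rewrite x0 => /eqP.
  move: (unit1 _ a0) (unit1 _ a0') => a1 a1'; subst alpha alpha'.
  split=> //; exists 1; split=> [|x]; first exact: oner_neq0.
  rewrite invr1 !mul1r.
  (* An idempotent exists exactly when [Psi 0 = 0], and on two points [Psi 0] determines a
     nonconstant function. *)
  have fixE (Psi : F -> F) u :
      (even_op 1 Psi u u == u) = (u.2 == 0) && (Psi 0 == 0).
    rewrite /even_op !mul1r subrr; case: u => a y /=; rewrite -pair_eqE /pair_eq /=.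
    rewrite -subr_eq0 addrAC subrr add0r; congr (_ && _).
    by rewrite -subr_eq0 addrAC subrr add0r.
  have E0 : (Phi 0 == 0) = (Phi' 0 == 0).
    apply/idP/idP=> P0.
      have : even_op 1 Phi (0, 0) (0, 0) == (0, 0) by rewrite fixE eqxx.
      move/eqP/(congr1 m); rewrite mM => /eqP; rewrite fixE => /andP[_] //.
    have : even_op 1 Phi' (0, 0) (0, 0) == (0, 0) by rewrite fixE eqxx.
    rewrite -[(0, 0)]m'K -mM => /eqP/(can_inj mK)/eqP.
    by rewrite fixE => /andP[_].
  have P0 : Phi 0 = Phi' 0.
    have [e|n] := boolP (Phi 0 == 0); first by rewrite (eqP e); move: e;
        rewrite E0 => /eqP.
    by rewrite (unit1 _ n); rewrite E0 in n; rewrite (unit1 _ n).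
  have P1 (Psi : F -> F) : (exists k, Psi k != Psi 0) -> Psi 1 = 1 - Psi 0.
    case=> k; have /orP[/eqP->|/eqP-> n1] := F2 k; first by rewrite eqxx.
    have /orP[/eqP z0|/eqP z0] := F2 (Psi 0).
      by rewrite z0 subr0; apply: unit1; rewrite -z0.
    rewrite z0 subrr; apply/eqP; have /orP[//|/eqP o1] := F2 (Psi 1).
    by move: n1; rewrite o1 z0 eqxx.
  have /orP[/eqP->|/eqP->] := F2 x; first exact: P0.
  by rewrite !P1 // P0.
have opop (al : F) (Psi : F -> F) u v w :
    (forall k, Psi (al * k) = al * Psi k) ->
    even_op al Psi (even_op al Psi u v) (even_op al Psi u w)
    = (al * (al * (w.1 + (u.2 + v.2 + Psi (v.1 - u.1)))),
       al * (al * (w.2 + (Psi (w.1 - u.1) + Psi (w.1 - v.1))))).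
  move=> PsiM; rewrite /even_op /=; congr (_, _); first by ring.
  have -> : al * w.1 + al * u.2 - (al * v.1 + al * u.2) = al * (w.1 - v.1) by ring.
  by rewrite PsiM; ring.
have parP (al : F) (Psi : F -> F) u v u' v' : al != 0 ->
    (forall k, Psi (al * k) = al * Psi k) ->
    (forall w, even_op al Psi (even_op al Psi u v) (even_op al Psi u w)
             = even_op al Psi (even_op al Psi u' v') (even_op al Psi u' w))
    <-> parallelogram Psi u v u' v'.
  move=> al0 PsiM; split=> [eqw|[e1 e2] w]; last by rewrite !opop // e1 e2.
  split=> [|b].
    have := eqw (0, 0); rewrite !opop // => -[].
    by move=> /(mulfI al0)/(mulfI al0)/addrI.
  have := eqw (b, 0); rewrite !opop // => -[_].
  by move=> /(mulfI al0)/(mulfI al0)/addrI.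
have mP u v u' v' : parallelogram Phi u v u' v' ->
    parallelogram Phi' (m u) (m v) (m u') (m v').
  move/(parP alpha _ _ _ _ _ a0 PhiM) => eqw.
  apply/(parP alpha' _ _ _ _ _ a0' PhiM') => w.
  by rewrite -(m'K w) -!mM eqw.
have [r [n [chi [chi0 mE]]]] :=
  parallelogram_fibres charF cardF p2 (can_inj mK) ncPhi' evPhi' mP.
have e1 a x b : r (alpha * b + alpha * x) = alpha' * r b + alpha' * (chi * x + n a).
  by have := mM (a, x) (b, 0); rewrite /even_op /= !mE => -[].
have e2 a b y : chi * (alpha * y + alpha * Phi (b - a)) + n (alpha * b)
     = alpha' * (chi * y + n b) + alpha' * Phi' (r b - r a).
  by have := mM (a, 0) (b, y); rewrite /even_op /= !mE mulr0 addr0 => -[].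
have nE a : n a = n 0.
  have := e1 a 0 0; rewrite (e1 0 0 0) !mulr0 !add0r => /addrI/(mulfI a0').
  by [].
have aa : alpha = alpha'.
  apply: (mulfI chi0); have := congr2 (fun s t => s - t) (e2 0 0 1) (e2 0 0 0).
  set L := _ - _; set R := _ - _ => LR.
  have -> : chi * alpha = L by rewrite /L; ring.
  by rewrite LR /R; ring.
subst alpha'; split=> //.
have rE b : r b = chi * b + r 0.
  have eb := e1 0 (alpha^-1 * b) 0; have e0 := e1 0 0 0.
  rewrite !mulr0 !add0r in e0; rewrite mulr0 add0r mulVKf // in eb.
  by rewrite eb [in RHS]e0; field.
pose d := n 0 * (1 - alpha) / alpha.
have PE k : Phi' (chi * k) = chi * Phi k + d.
  have := e2 0 k 0; rewrite rE addrK subr0 !(nE (_ * _)) (nE k) => e.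
  apply: (mulfI a0); apply: (addrI (alpha * (chi * 0 + n 0))); rewrite -e /d.
  by field.
(* Homogeneity of both functions gives [(alpha - 1) * d = 0], and for [alpha = 1] the formula for
   [d] is 0. *)
have d0 : d = 0.
  have := PE (alpha * 0); rewrite mulrCA PhiM' PE PhiM => /eqP; rewrite -subr_eq0.
  have -> : alpha * (chi * Phi 0 + d) - (chi * (alpha * Phi 0) + d) = (alpha -
      1) * d by ring.
  rewrite mulf_eq0 => /orP[|/eqP //]; rewrite subr_eq0 => /eqP al1.
  by rewrite /d al1 subrr mulr0 mul0r.
exists chi^-1; split=> [|x]; first by rewrite invr_eq0.
by rewrite invrK -[in RHS](mulVKf chi0 x) PE d0 addr0.
Qed.

End IsomorphismInvariants.

(** * Classification, isomorphism criteria and exclusivity *)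

Lemma nonconstantP (F : finFieldType) (Phi : F -> F) :
  nonconstant Phi <-> exists k, Phi k != Phi 0.
Proof.
split=> [nc|[k nk] [c Phic]]; last by move: nk; rewrite !Phic eqxx.
apply/existsP; apply: contraT => /existsPn Phi0; case: nc; exists (Phi 0) => x.
by have := Phi0 x; rewrite negbK => /eqP.
Qed.

Lemma isomorphic_sym (X Y : cycleSetType) : isomorphic X Y -> isomorphic Y X.
Proof.
case=> f [[g fK gK] fM]; exists g; split; first by exists f.
by move=> x y; apply: (can_inj fK); rewrite fM !gK.
Qed.

Lemma isomorphic_trans (X Y Z : cycleSetType) :
  isomorphic X Y -> isomorphic Y Z -> isomorphic X Z.
Proof.
case=> f [bf fM] [g [bg gM]]; exists (g \o f); split; first exact: bij_comp.
by move=> x y; rewrite /= fM gM.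
Qed.

(** Having the same left multiplication is invariant under isomorphism; [exclusive_forms] separates
    the three forms by this relation. *)
Lemma isomorphic_cdot_eq (X Y : cycleSetType) : isomorphic X Y ->
  exists f : X -> Y, bijective f /\
    forall u v, (forall w, cdot u w = cdot v w) <-> (forall w,
        cdot (f u) w = cdot (f v) w).
Proof.
case=> f [bf fM]; exists f; split=> // u v; have [g fK gK] := bf.
split=> e w; first by rewrite -(gK w) -!fM e.
by apply: (can_inj fK); rewrite !fM e.
Qed.

(** The permutation group is cyclic and transitive, hence regular, so [k] can be matched with the
    image of [x0] under [t^k]. *)
Lemma cyclic_isomorphic (p : nat) (X : cycleSetType) (t : {perm X}) :
  prime p -> #|X| = (p ^ 2)%N -> (forall x, sigma x = t) ->
  [transitive permgrp X, on [set: X] | 'P] -> of_cyclic_form p X.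
Proof.
move=> p_pr cardX tE trG.
have card_gt1 : (1 < p ^ 2)%N by rewrite -{1}(exp1n 2) ltn_exp2r ?prime_gt1.
have [x0 _] : exists x0, x0 \in X by apply/card_gt0P; rewrite cardX ltnW.
have defG : permgrp X :=: <[t]>%g.
  congr (<<_>>%g); apply/setP=> g; rewrite inE; apply/imsetP/eqP=> [[x _ ->] //|->].
  by exists x0; rewrite ?tE.
have trt : [transitive <[t]>, on [set: X] | 'P] by rewrite -defG.
have toX x : exists2 g, g \in <[t]>%g & g x0 = x.
  have : x \in orbit 'P <[t]> x0 by rewrite (atransP trt) ?inE.
  by case/orbitP=> g tg <-; exists g.
have semireg g h : g \in <[t]>%g -> h \in <[t]>%g -> g x0 = h x0 -> g = h.
  move=> /cycleP[i ->] /cycleP[j ->] eq0; apply/permP=> x.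
  have [_ /cycleP[k ->] <-] := toX x.
  by rewrite -!permM -!expgD ![(k + _)%N]addnC !expgD !permM eq0.
(* The order is stated as the modulus with which ['Z_(p ^ 2)] computes; it equals [p ^ 2] because
   [p ^ 2 > 1]. *)
have ot : #[t]%g = (Zp_trunc (p ^ 2)).+2.
  rewrite Zp_cast // -cardX -cardsT -(atransP trt x0) ?inE // orderE.
  have inj : {in <[t]>%g &, injective (fun g : {perm X} => g x0)}.
    by move=> g h tg th; apply: semireg.
  rewrite -(card_in_imset inj); apply: eq_card => x.
  by apply/imsetP/orbitP=> -[g tg gx]; exists g.
pose E (k : cyclic_cs p) : X := (t ^+ (k : 'Z_(p ^ 2)))%g x0.
have E_inj : injective E.
  move=> k l /semireg; rewrite !mem_cycle => /(_ isT isT)/eqP.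
  rewrite eq_expg_mod_order ot => /eqP; rewrite !modn_small ?ltn_ord // => kl.
  exact: val_inj.
apply: isomorphic_sym; exists E; split.
  by apply: inj_card_bij => //; rewrite cardX card_ord Zp_cast.
move=> k l; rewrite -[RHS]sigmaE tE /E -permM -expgSr; congr (fun_of_perm _ x0).
rewrite -[RHS]expg_mod_order ot; congr (_ ^+ _)%g.
by rewrite /= modnDmr addn1.
Qed.

Theorem classification (p : nat) (X : cycleSetType) : prime p ->
  indecomposable X -> #|X| = (p ^ 2)%N ->
  [\/ of_cyclic_form p X, of_shift_form p X | of_even_form p X].
Proof.
move=> p_pr indec cardX.
have charF := pchar_Fp p_pr; have cardF := card_Fp p_pr.
have cardX0 : (0 < #|X|)%N by rewrite cardX expn_gt0 prime_gt0.
have trG := indecomposable_transitive cardX0 indec.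
have isoP (Y : cycleSetType) (E : Y -> X) :
    bijective E -> {morph E : u v / cdot u v >-> cdot u v} -> isomorphic X Y.
  by move=> bE EM; apply: isomorphic_sym; exists E.
have [e [be [[f eE]|[Phi [ncPhi evPhi eE]]]]] :=
    splitting_pgroup_form charF cardF cardX trG.
  have Q1 := shift_like_coprime_trivial charF cardF cardX trG be eE.
  have sigmaT (x : X) : sigma x = part p x.
    by rewrite (sigma_split p x) (Q1 _ (part_in p^' _)) mulg1.
  have [h [Phi [Phi0 fE]]] := shift_like_cocycle charF cardF be eE.
  have [e' eK e'K] := be.
  have [/forallP Pconst|/forallPn ncPhi] := boolP [forall k, Phi k == Phi 0].
    apply: Or31; apply: (cyclic_isomorphic (t := sigma (e (0, 0)))) => // x.
    apply/permP=> z; rewrite !sigmaT -(e'K x) -(e'K z).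
    case: (e' x) (e' z) => [a y] [b w]; rewrite !eE !fE.
    by rewrite (eqP (Pconst (b - a))) (eqP (Pconst (b - 0))).
  (* Both [h] and [chi0] times [S] have total [S], so their difference is the increment of some
     [mu]. Translating the fibre over [b] by [mu b] replaces [h b] by [chi0 b * S]. *)
  apply: Or32; pose S := \sum_(i < p) h i%:R.
  have [|mu muE] := cyclic_primitive charF cardF (k := fun b => h b - chi0 b * S).
    suff chi_sum : \sum_(i < p) chi0 (i%:R : 'F_p) = 1.
      by rewrite sumrB -big_distrl /= chi_sum mul1r subrr.
    rewrite (bigD1 (Ordinal (prime_gt0 p_pr))) //= /chi0 mulr0n eqxx big1
        ?addr0 // => i i0.
    rewrite -(dvdn_pcharf charF) gtnNdvd //.
    by rewrite lt0n; apply: contraNneq i0 => i0; apply/eqP/val_inj.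
  exists S, Phi; split; first by split=> //; apply/nonconstantP.
  apply: (isoP (shift_cs S Phi) (fun u => e (u.1, u.2 + mu u.1))).
    apply: (bij_comp be); exists (fun u => (u.1, u.2 - mu u.1)) => -[a x] /=.
      by rewrite addrK.
    by rewrite subrK.
  move=> [a x] [b y]; rewrite -[RHS]sigmaE sigmaT eE fE /cdot /=.
  by congr (e (_, _)); rewrite muE; ring.
apply: Or33.
have [al [r0 [g [al0 Qg sigmaT gE PhiM]]]] :=
  even_like_structure charF cardF cardX trG be eE ncPhi evPhi.
(* The origin of the first coordinate is moved to a fixed point of [g] on the fibres. For [al = 1]
   the shift [r0] vanishes because the order of [g] is prime to [p]. *)
have [c cE] : exists c, al * c + r0 = c.
  have [al1|al1] := eqVneq al 1; last first.
    exists (r0 / (1 - al)).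
    have al1' : 1 - al != 0 by rewrite subr_eq0 eq_sym.
    by apply: (mulIf al1'); rewrite mulrDl -mulrA !divfK //; ring.
  have [e' eK e'K] := be.
  exists 0; rewrite mulr0 add0r.
  apply: (coprime_shift_trivial charF cardX Qg (I := fun u => (e' u).1)) => u.
  by rewrite -(e'K u); case: (e' u) => b y; rewrite gE !eK /= al1 mul1r.
have adm : even_admissible al Phi.
  by split=> //; [apply/nonconstantP | rewrite unitfE].
exists al, Phi, adm.
apply: (isoP (even_cs adm) (fun u => e (u.1 + c, u.2))).
  apply: (bij_comp be); exists (fun u => (u.1 - c, u.2)) => -[a x] /=.
    by rewrite addrK.
  by rewrite subrK.
move=> [a x] [b y]; rewrite -[RHS]sigmaE sigmaT permM eE gE /cdot /=.
congr (e (_, _)); last by rewrite mulrDr; congr (_ + _ * Phi _); ring.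
by rewrite -{1}cE; ring.
Qed.

Lemma shift_cdotE (p : nat) (S : 'F_p) (Phi : 'F_p -> 'F_p) (u v : shift_cs S Phi) :
  cdot u v = shift_op S Phi u v.
Proof. by case: u v => [a x] [b y]. Qed.

Lemma even_cdotE (p : nat) (al : 'F_p) (Phi : 'F_p -> 'F_p)
    (adm : even_admissible al Phi) (u v : even_cs adm) :
  cdot u v = even_op al Phi u v.
Proof. by case: u v => [a x] [b y]. Qed.

Theorem shift_criterion (p : nat) (S S' : 'F_p) (Phi Phi' : 'F_p -> 'F_p) :
  prime p -> shift_admissible Phi -> shift_admissible Phi' ->
  isomorphic (shift_cs S Phi) (shift_cs S' Phi') <->
  exists alpha : 'F_p,
    [/\ alpha \is a GRing.unit, alpha * S = S' & forall x, alpha * Phi x = Phi' x].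
Proof.
move=> p_pr [/nonconstantP nc Phi0] [/nonconstantP nc' Phi0'].
have charF := pchar_Fp p_pr; have cardF := card_Fp p_pr.
split=> [[m [bm mM]]|[al [alU SE PhiE]]].
  have mM' : {morph m : u v / shift_op S Phi u v >-> shift_op S' Phi' u v}.
    by move=> u v; rewrite -!shift_cdotE; apply: mM.
  have [al [al0 SE PhiE]] := shift_iso_params charF cardF bm mM' Phi0 Phi0' nc nc'.
  by exists al; rewrite unitfE.
subst S'; exists (fun u : 'F_p * 'F_p => (u.1, al * u.2)); split.
  by exists (fun u : 'F_p * 'F_p => (u.1, al^-1 * u.2)) => -[a x] /=;
      rewrite ?mulKr ?mulVKr.
by case=> [a x] [b y]; congr (_, _) => /=; rewrite -PhiE; ring.
Qed.

Theorem even_criterion (p : nat) (al al' : 'F_p) (Phi Phi' : 'F_p -> 'F_p)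
    (adm : even_admissible al Phi) (adm' : even_admissible al' Phi') :
  prime p ->
  isomorphic (even_cs adm) (even_cs adm') <->
  al = al' /\ exists beta : 'F_p,
     beta \is a GRing.unit /\ forall x, beta^-1 * Phi (beta * x) = Phi' x.
Proof.
move=> p_pr; have charF := pchar_Fp p_pr; have cardF := card_Fp p_pr.
have [/nonconstantP nc ev alU PhiM] := adm;
    have [/nonconstantP nc' ev' alU' PhiM'] := adm'.
split=> [[m [bm mM]]|[eq_al [be [beU PhiE]]]].
  have mM' : {morph m : u v / even_op al Phi u v >-> even_op al' Phi' u v}.
    by move=> u v; rewrite -!even_cdotE; apply: mM.
  rewrite unitfE in alU; rewrite unitfE in alU'.
  have [-> [be [be0 PhiE]]] :=
    even_iso_params charF cardF bm mM' alU alU' nc nc' ev' PhiM PhiM'.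
  by split=> //; exists be; rewrite unitfE.
subst al'; exists (fun u : 'F_p * 'F_p => (be^-1 * u.1, be^-1 * u.2)); split.
  by exists (fun u : 'F_p * 'F_p => (be * u.1, be * u.2)) => -[a x] /=;
     rewrite ?mulVKr ?mulKr.
case=> [a x] [b y]; congr (_, _) => /=; rewrite -?PhiE.
  by ring.
by rewrite mulrBr !mulVKr //; ring.
Qed.

Lemma cyclic_cdot_const (p : nat) (x y z : cyclic_cs p) : cdot x z = cdot y z.
Proof. by []. Qed.

(** Equal left multiplications occur for all pairs in the cyclic form, exactly for equal first
    coordinates in the shift form, and only for equal elements in the even form. *)
Theorem exclusive_forms (p : nat) (X : cycleSetType) : prime p ->
     [/\ ~ (of_cyclic_form p X /\ of_shift_form p X),
         ~ (of_cyclic_form p X /\ of_even_form p X) &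
         ~ (of_shift_form p X /\ of_even_form p X)].
Proof.
move=> p_pr; have charF := pchar_Fp p_pr; have cardF := card_Fp p_pr.
have even_faithful (al : 'F_p) (Phi : 'F_p ->
    'F_p) (adm : even_admissible al Phi) (u v : even_cs adm) :
    (forall w, cdot u w = cdot v w) -> u = v.
  have [/nonconstantP nc ev alU _] := adm.
  case: u v => [a x] [a' x'] e.
  have E b : al * b + al * x = al * b + al * x'
          /\ al * 0 + al * Phi (b - a) = al * 0 + al * Phi (b - a').
    have := e (b, 0); rewrite !even_cdotE => eb.
    by split; [exact: (congr1 fst eb) | exact: (congr1 snd eb)].
  congr (_, _).
    apply: (shift_separated charF cardF nc) => b.
    by apply: (mulrI alU); apply: (addrI (al * 0)); have [_ ->] := E b.
  by apply: (mulrI alU); apply: (addrI (al * 0)); have [-> _] := E 0.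
split=> -[].
- move=> cX [S [Phi [[/nonconstantP nc _] sX]]].
  have [f [bf fE]] := isomorphic_cdot_eq (isomorphic_trans (isomorphic_sym cX) sX).
  have [g fK gK] := bf.
  have e (u v : shift_cs S Phi) w : cdot u w = cdot v w.
    by rewrite -(gK u) -(gK v); move: w; apply/fE => w; apply: cyclic_cdot_const.
  have /eqP := oner_neq0 'F_p; apply.
  apply: (shift_separated charF cardF nc) => b.
  by have := e (1, 0) (0, 0) (b, 0); rewrite !shift_cdotE => /(congr1 snd)/addrI.
- move=> cX [al [Phi [adm eX]]].
  have [f [bf fE]] := isomorphic_cdot_eq (isomorphic_trans (isomorphic_sym cX) eX).
  have [g fK gK] := bf.
  have /even_faithful : forall w, cdot ((0, 0) :
      even_cs adm) w = cdot ((1, 0) : even_cs adm) w.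
    by rewrite -(gK (0, 0)) -(gK (1, 0)); apply/fE => w; apply: cyclic_cdot_const.
  by move=> -[] /eqP; rewrite eq_sym oner_eq0.
move=> [S [Phi [_ sX]]] [al [Psi [adm eX]]].
have [f [bf fE]] := isomorphic_cdot_eq (isomorphic_trans (isomorphic_sym sX) eX).
have : forall w, cdot (f (0, 0)) w = cdot (f (0, 1)) w by apply/fE; case.
by move/even_faithful/(bij_inj bf) => -[] /eqP; rewrite eq_sym oner_eq0.
Qed.

Theorem theorem5p1 (p : nat) (p_prime : prime p) :
  (forall X : cycleSetType,
     indecomposable X -> #|X| = (p ^ 2)%N ->
     [\/ of_cyclic_form p X, of_shift_form p X | of_even_form p X])
  /\
  (forall (S S' : 'F_p) (Phi Phi' : 'F_p -> 'F_p),
     shift_admissible Phi -> shift_admissible Phi' ->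
     (isomorphic (shift_cs S Phi) (shift_cs S' Phi') <->
      exists alpha : 'F_p,
        [/\ alpha \is a GRing.unit, alpha * S = S' &
            forall x : 'F_p, alpha * Phi x = Phi' x]))
  /\
  (forall (alpha alpha' : 'F_p) (Phi Phi' : 'F_p -> 'F_p)
          (adm : even_admissible alpha Phi)
          (adm' : even_admissible alpha' Phi'),
     (isomorphic (even_cs adm) (even_cs adm') <->
      alpha = alpha' /\
      exists beta : 'F_p,
        beta \is a GRing.unit /\
        forall x : 'F_p, beta^-1 * Phi (beta * x) = Phi' x))
  /\
  (forall X : cycleSetType,
     [/\ ~ (of_cyclic_form p X /\ of_shift_form p X),
         ~ (of_cyclic_form p X /\ of_even_form p X) &
         ~ (of_shift_form p X /\ of_even_form p X)]).
Proof.
split; first by move=> X; apply: classification.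
split; first by move=> S S' Phi Phi' admS admS'; apply: shift_criterion.
split; first by move=> *; apply: even_criterion.
by move=> X; apply: exclusive_forms.
Qed.
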